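(* Let $J,J_1$ be non-infinitesimal intervals of ${}^\bullet\mathbb{R}$, let $u,v\in J_1$, and let $\phi:J_1\to J$ and $f:J\to{}^\bullet\mathbb{R}$ be smooth functions. Then $$\int_{\phi(u)}^{\phi(v)}f(t)\,\mathrm{d}t=\int_u^v f[\phi(s)]\cdot\phi'(s)\,\mathrm{d}s.$$
   Context: Fermat reals: let $\mathbb{R}_o[t]$ be the set of maps $x:\mathbb{R}_{\ge0}\to\mathbb{R}$, $t\mapsto x_t$, of the form $x_t=r+\sum_{i=1}^k\alpha_i t^{a_i}+o(t)$ as $t\to0^+$, with $k\in\mathbb{N}$, $r,\alpha_i\in\mathbb{R}$, $a_i\in\mathbb{R}_{\ge0}$. Write $x\sim y$ iff $x_t=y_t+o(t)$ as $t\to0^+$. The ring of Fermat reals is ${}^\bullet\mathbb{R}:=\mathbb{R}_o[t]/\sim$ with pointwise operations; $\mathbb{R}\subseteq{}^\bullet\mathbb{R}$ via constants. The standard part of $x=[x_t]$ is ${}^\circ x:=x_0$. ${}^\bullet\mathbb{R}$ is totally ordered by: $x\le y$ iff for representatives there is $z\in\mathbb{R}_o[t]$ with $z\sim0$ and $x_t\le y_t+z_t$ for all small $t\ge0$. $\overline{{}^\bullet\mathbb{R}}:={}^\bullet\mathbb{R}\cup\{\pm\infty\}$, ${}^\circ(\pm\infty):=\pm\infty$. An interval is a set $[a,b],(a,b),[a,b),(a,b]$ of points of ${}^\bullet\mathbb{R}$ with $a\le b$ in $\overline{{}^\bullet\mathbb{R}}$; non-infinitesimal if ${}^\circ a<{}^\circ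 b$. The Fermat topology on ${}^\bullet\mathbb{R}^n$ has open sets ${}^\bullet V:=\{x:{}^\circ x\in V\}$, $V\subseteq\mathbb{R}^n$ open. For $\alpha\in C^\infty(W,\mathbb{R}^m)$, $W\subseteq\mathbb{R}^d$ open, ${}^\bullet\alpha([x_t]):=[\alpha(x_t)]$. A map $f:S\to{}^\bullet\mathbb{R}^m$, $S\subseteq{}^\bullet\mathbb{R}^n$, is smooth if for every $x\in S$ there exist open $V\subseteq\mathbb{R}^n$ with $x\in{}^\bullet V$, open $P\subseteq\mathbb{R}^{\mathsf p}$, $p\in{}^\bullet P$, $\alpha\in C^\infty(P\times V,\mathbb{R}^m)$ with $f(y)={}^\bullet\alpha(p,y)$ for $y\in{}^\bullet V\cap S$. For $f$ smooth on a non-infinitesimal interval $J$ and $x\in J$, $f'(x):={}^\bullet(\partial_2\alpha)(p,x)$ for any local representation of $f$ around $x$ (independent of it). Integral: for a non-infinitesimal interval $J$, smooth $f:J\to{}^\bullet\mathbb{R}$ and $u\in J$, $\int_u^{(-)}f$ is the unique smooth $I:J\to{}^\bullet\mathbb{R}$ with $I(u)=0$ and $I'(x)=f(x)$ for all $x\in J$, and $\int_u^v f=\int_u^v f(s)\,\mathrm{d}s:=I(v)$ for $v\in J$. *)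

(* Defs.v *)
From Stdlib Require Import Reals Lra List ClassicalEpsilon Classical.
From Coquelicot Require Import Coquelicot.
From mathcomp Require Import ssreflect ssrfun ssrbool eqtype ssrnat fintype.
Open Scope R_scope.

(* t^a for t >= 0 and a >= 0, with the convention t^0 = 1 (also at t = 0). *)
Definition tpow (t a : R) : R :=
  if Req_EM_T a 0 then 1 else if Rlt_dec 0 t then Rpower t a else 0.

Definition poly_part (r : R) (l : list (prod R R)) (t : R) : R :=
  r + fold_right (fun p acc => fst p * tpow t (snd p) + acc) 0 l.

(* w = o(t) as t -> 0^+ : w(t) = t * eps(t) with eps(t) -> 0, so w(0) = 0 *)
Definition little_o (w : R -> R) : Prop :=
  w 0 = 0 /\
  forall eps, 0 < eps -> exists delta, 0 < delta /\
    forall t, 0 < t < delta -> Rabs (w t) <= eps * t.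

(* R_o[t] (maps are total on R, only the values for t >= 0 matter) *)
Definition Ro (x : R -> R) : Prop :=
  exists (r : R) (l : list (prod R R)),
    List.Forall (fun p => 0 <= snd p) l /\ little_o (fun t => x t - poly_part r l t).

Definition sim (x y : R -> R) : Prop := little_o (fun t => x t - y t).

Definition FR : Type :=
  { S : (R -> R) -> Prop | exists x, Ro x /\ forall y, S y <-> (Ro y /\ sim x y) }.

Definition is_rep (X : FR) (x : R -> R) : Prop := proj1_sig X x.

Lemma sim_refl (x : R -> R) : sim x x.
Proof.
  split; first by rewrite Rminus_diag.
  move=> eps Heps; exists 1; split; first lra.
  move=> t Ht; rewrite Rminus_diag Rabs_R0; nra.
Qed.

Lemma rep_ex (X : FR) : exists x, is_rep X x.
Proof.
  case: X => S [x [Hx HS]]; exists x; rewrite /is_rep /=.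
  by apply/HS; split => //; apply: sim_refl.
Qed.

Definition repr (X : FR) : R -> R :=
  proj1_sig (constructive_indefinite_description _ (rep_ex X)).

Lemma Ro_const0 : Ro (fun _ => 0).
Proof.
  exists 0, nil; split; first by constructor.
  rewrite /poly_part /=; split; first lra.
  move=> eps Heps; exists 1; split; first lra.
  move=> t Ht; have -> : 0 - (0 + 0) = 0 by lra.
  rewrite Rabs_R0; nra.
Qed.

Definition FR0 : FR :=
  exist _ (fun y => Ro y /\ sim (fun _ => 0) y)
    (ex_intro _ (fun _ => 0) (conj Ro_const0 (fun y => iff_refl _))).

(* class of a map; the (never used in the theorem) junk value FR0 if x is not in R_o[t] *)
Definition cls (x : R -> R) : FR :=
  match excluded_middle_informative (Ro x) with
  | left H => exist _ (fun y => Ro y /\ sim x y)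
                 (ex_intro _ x (conj H (fun y => iff_refl _)))
  | right _ => FR0
  end.

Definition FRmul (X Y : FR) : FR := cls (fun t => repr X t * repr Y t).

Definition std (X : FR) : R := repr X 0.

Definition FRle (X Y : FR) : Prop :=
  exists x y z, is_rep X x /\ is_rep Y y /\ Ro z /\ sim z (fun _ => 0) /\
    exists delta, 0 < delta /\ forall t, 0 <= t < delta -> x t <= y t + z t.

Inductive FRbar := FFin (x : FR) | FPinf | FMinf.

Definition FRbar_le (a b : FRbar) : Prop :=
  match a, b with
  | FMinf, _ => True
  | _, FPinf => True
  | FFin x, FFin y => FRle x y
  | _, _ => False
  end.

Definition FRbar_lt (a b : FRbar) : Prop := FRbar_le a b /\ a <> b.

Definition std_bar (a : FRbar) : Rbar :=
  match a with FFin x => Rbar.Finite (std x) | FPinf => p_infty | FMinf => m_infty end.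

Inductive ikind := CC | OO | CO | OC.

Definition interval_set (k : ikind) (a b : FRbar) (x : FR) : Prop :=
  match k with
  | CC => FRbar_le a (FFin x) /\ FRbar_le (FFin x) b
  | OO => FRbar_lt a (FFin x) /\ FRbar_lt (FFin x) b
  | CO => FRbar_le a (FFin x) /\ FRbar_lt (FFin x) b
  | OC => FRbar_lt a (FFin x) /\ FRbar_le (FFin x) b
  end.

Definition noninf_interval (J : FR -> Prop) : Prop :=
  exists (k : ikind) (a b : FRbar),
    FRbar_le a b /\ Rbar_lt (std_bar a) (std_bar b) /\
    forall x, J x <-> interval_set k a b x.

Definition vec (d : nat) := 'I_d -> R.

Definition openR (V : R -> Prop) : Prop :=
  forall x, V x -> exists delta, 0 < delta /\ forall y, Rabs (y - x) < delta -> V y.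

Definition openv {d : nat} (U : vec d -> Prop) : Prop :=
  forall x, U x -> exists delta, 0 < delta /\
    forall y : vec d, (forall i, Rabs (y i - x i) < delta) -> U y.

Definition contin_at {d : nat} (f : vec d -> R) (x : vec d) : Prop :=
  forall eps, 0 < eps -> exists delta, 0 < delta /\
    forall y : vec d, (forall i, Rabs (y i - x i) < delta) -> Rabs (f y - f x) < eps.

Definition upd {d : nat} (x : vec d) (i : 'I_d) (h : R) : vec d :=
  fun j => if j == i then h else x j.

Definition partial {d : nat} (i : 'I_d) (f : vec d -> R) : vec d -> R :=
  fun x => Derive (fun h => f (upd x i h)) (x i).

Fixpoint Ck {d : nat} (n : nat) (U : vec d -> Prop) (f : vec d -> R) : Prop :=
  (forall x, U x -> contin_at f x) /\
  match n with
  | O => True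
  | S m => forall i : 'I_d,
      (forall x, U x -> ex_derive (fun h => f (upd x i h)) (x i)) /\ Ck m U (partial i f)
  end.

Definition Cinf {d : nat} (U : vec d -> Prop) (f : vec d -> R) : Prop :=
  forall n, Ck n U f.

Definition vcons {T : Type} {n : nat} (y : T) (q : 'I_n -> T) : 'I_n.+1 -> T :=
  fun i => match unlift ord0 i with Some j => q j | None => y end.

Definition ext {d : nat} (alpha : vec d -> R) (X : 'I_d -> FR) : FR :=
  cls (fun t => alpha (fun i => repr (X i) t)).

(* f(y) = •alpha(p, y) for y in •V ∩ S, alpha ∈ C^∞(V × P); the coordinate
   y is coordinate 0 of alpha, so ∂_2 alpha is [partial ord0 alpha]. *)
Definition local_rep (S : FR -> Prop) (f : FR -> FR) (x : FR)
  (V : R -> Prop) (pd : nat) (P : vec pd -> Prop) (p : 'I_pd -> FR)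
  (alpha : vec pd.+1 -> R) : Prop :=
  openR V /\ V (std x) /\ openv P /\ P (fun i => std (p i)) /\
  Cinf (fun z : vec pd.+1 => V (z ord0) /\ P (fun j => z (lift ord0 j))) alpha /\
  forall y, S y -> V (std y) -> f y = ext alpha (vcons y p).

Definition smooth (S : FR -> Prop) (f : FR -> FR) : Prop :=
  forall x, S x -> exists V pd P p alpha, local_rep S f x V pd P p alpha.

Definition is_deriv (S : FR -> Prop) (f : FR -> FR) (x d : FR) : Prop :=
  exists V pd P p alpha, local_rep S f x V pd P p alpha /\
    d = ext (partial ord0 alpha) (vcons x p).

(* f'(x) (well defined by the paper; junk FR0 if no local representation) *)
Definition deriv (S : FR -> Prop) (f : FR -> FR) (x : FR) : FR :=
  match excluded_middle_informative (exists d, is_deriv S f x d) with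
  | left H => proj1_sig (constructive_indefinite_description _ H)
  | right _ => FR0
  end.

Definition is_primitive (J : FR -> Prop) (f : FR -> FR) (u : FR) (I : FR -> FR) : Prop :=
  smooth J I /\ I u = FR0 /\ forall x, J x -> deriv J I x = f x.

(* \int_u^v f  (the primitive is unique by the paper) *)
Definition integral (J : FR -> Prop) (f : FR -> FR) (u v : FR) : FR :=
  match excluded_middle_informative (exists I, is_primitive J f u I) with
  | left H => (proj1_sig (constructive_indefinite_description _ H)) v
  | right _ => FR0
  end.

(* Main.v *)
(* Expanding the parameters of a local representation in powers of t turns every smooth
   function, near a standard point, into a finite sum f(y) = sum_k t^(c_k) a_k(y) with a_k
   smooth of one real variable, and f'(y) = sum_k t^(c_k) a_k'(y). Grouping equal
   exponents, the coefficients of exponent at most 1 are determined by the values of f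
   at real points (exponents above 1 are o(t)). Hence the derivative is well defined, a
   function with zero derivative is locally constant, and so constant by connectedness of
   the set of standard parts. Integrating the a_k gives local primitives, which glue to a
   global primitive I of f vanishing at phi(u). By the chain rule I o phi is a primitive of
   (f o phi) phi' vanishing at u, and both sides are equal to I(phi(v)). *)
Require Import Defs.
From Stdlib Require Import Reals Lra Lia List ClassicalEpsilon.
From Stdlib Require Import FunctionalExtensionality PropExtensionality.
From Coquelicot Require Import Coquelicot.
From mathcomp Require Import ssreflect ssrfun ssrbool eqtype ssrnat seq fintype.
Open Scope R_scope.

(** The expansions are finite because infinitesimals are nilpotent: a map in R_o[t] satisfies x_t -
    x_0 = O(t^a) for some a > 0, so a Taylor expansion in this increment can stop at any n with n a
    > 1, the remainder being o(t). The remainder must also be uniform in the real variable y,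
    because a Fermat real is later substituted for y and its representative moves with t. The
    obstacle is the end of an interval. J may hold points infinitesimally beyond its last real
    point, where agreement at real points says nothing directly. But a coefficient that vanishes on
    an open real interval is flat at its ends: all its derivatives vanish there by continuity, and a
    flat function of x_t is o(t), by nilpotency again. Uniqueness of derivatives and of primitives
    both rest on this. Points with the same standard part cannot be separated by Fermat open sets,
    so every local statement speaks of all points of J over a real neighbourhood. *)

(* [t = 0] is included because [little_o w] also asks for [w 0 = 0]. *)
Definition ev (P : R -> Prop) : Prop :=
  exists delta, 0 < delta /\ forall t, 0 <= t < delta -> P t.

Lemma ev_and P Q : ev P -> ev Q -> ev (fun t => P t /\ Q t).
Proof.
  move=> [d [Hd HP]] [e [He HQ]]; exists (Rmin d e); split; first exact: Rmin_pos.
  move=> t [H0 Ht]; have := Rmin_l d e; have := Rmin_r d e => H1 H2.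
  by split; [apply: HP | apply: HQ]; lra.
Qed.

Lemma ev_mono (P Q : R -> Prop) : (forall t, 0 <= t -> P t -> Q t) -> ev P -> ev Q.
Proof. by move=> H [d [Hd HP]]; exists d; split=> // t Ht; apply: H; [lra | apply: HP]. Qed.

Lemma ev_all (P : R -> Prop) : (forall t, 0 <= t -> P t) -> ev P.
Proof. by move=> H; exists 1; split; [lra | move=> t [Ht _]; apply: H]. Qed.

Lemma ev_lt d : 0 < d -> ev (fun t => t < d).
Proof. by move=> Hd; exists d; split=> // t []. Qed.

Lemma ev_0 P : ev P -> P 0.
Proof. by move=> [d [Hd H]]; apply: H; lra. Qed.

Lemma ev_list {T} (l : list T) (P : T -> R -> Prop) :
  (forall k, In k l -> ev (P k)) -> ev (fun t => forall k, In k l -> P k t).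
Proof.
  elim: l => [|a l IH] H; first by apply: ev_all.
  have Hl : ev (fun t => forall k, In k l -> P k t).
    by apply: IH => k Hk; apply: H; right.
  have Ha : ev (P a) by apply: H; left.
  apply: ev_mono (ev_and _ _ Ha Hl) => t _ [h1 h2] k [<-|Hk] //; exact: h2.
Qed.

Lemma little_oE w : little_o w <-> forall eps, 0 < eps -> ev (fun t => Rabs (w t) <= eps * t).
Proof.
  split.
  - move=> [H0 H] eps /H [d [Hd Ht]]; exists d; split=> // t [[H1|<-] H2].
      by apply: Ht.
    by rewrite H0 Rabs_R0; lra.
  - move=> H; split.
      have /ev_0 := H 1 Rlt_0_1; rewrite Rmult_0_r; have := Rabs_pos (w 0) => H1 H2.
      by apply: Rabs_eq_0; lra.
    by move=> eps /H [d [Hd Ht]]; exists d; split=> // t H1; apply: Ht; lra.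
Qed.

Lemma little_o_le w w' C :
  little_o w -> ev (fun t => Rabs (w' t) <= C * Rabs (w t)) -> little_o w'.
Proof.
  move=> /little_oE Hw H; apply/little_oE => eps Heps.
  (* [C] may be zero or negative, hence the division by [Rabs C + 1]. *)
  have HC : 0 < Rabs C + 1 by have := Rabs_pos C; lra.
  have He : 0 < eps / (Rabs C + 1) by apply: Rdiv_lt_0_compat.
  apply: ev_mono (ev_and _ _ H (Hw _ He)) => t Ht [H1 H2].
  have H3 : C * Rabs (w t) <= (Rabs C + 1) * Rabs (w t).
    by apply: Rmult_le_compat_r; [apply: Rabs_pos | have := Rle_abs C; lra].
  have H4 : (Rabs C + 1) * Rabs (w t) <= (Rabs C + 1) * (eps / (Rabs C + 1) * t).
    by apply: Rmult_le_compat_l; lra.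
  have H5 : (Rabs C + 1) * (eps / (Rabs C + 1) * t) = eps * t by field; lra.
  lra.
Qed.

Lemma little_o_ext w w' : ev (fun t => w t = w' t) -> little_o w -> little_o w'.
Proof.
  move=> H Hw; apply: (little_o_le _ _ 1 Hw); apply: ev_mono H => t _ ->; lra.
Qed.

Lemma little_o_add v w : little_o v -> little_o w -> little_o (fun t => v t + w t).
Proof.
  move=> /little_oE Hv /little_oE Hw; apply/little_oE => eps Heps.
  have He : 0 < eps / 2 by lra.
  apply: ev_mono (ev_and _ _ (Hv _ He) (Hw _ He)) => t _ [h1 h2].
  have := Rabs_triang (v t) (w t); lra.
Qed.

Lemma little_o_0 : little_o (fun _ => 0).
Proof.
  apply/little_oE => eps He; apply: ev_all => t Ht.
  by rewrite Rabs_R0; apply: Rmult_le_pos; lra.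
Qed.

Lemma little_o_scal b w M :
  ev (fun t => Rabs (b t) <= M) -> little_o w -> little_o (fun t => b t * w t).
Proof.
  move=> Hb Hw; apply: (little_o_le _ _ M Hw); apply: ev_mono Hb => t _ H.
  by rewrite Rabs_mult; apply: Rmult_le_compat_r; [apply: Rabs_pos|].
Qed.

Lemma little_o_opp w : little_o w -> little_o (fun t => - w t).
Proof.
  move=> Hw; apply: (little_o_le _ _ 1 Hw); apply: ev_all => t _; rewrite Rabs_Ropp; lra.
Qed.

Lemma sim_sym x y : sim x y -> sim y x.
Proof.
  move=> /little_o_opp; apply: little_o_ext; apply: ev_all => t _; ring.
Qed.

Lemma sim_trans x y z : sim x y -> sim y z -> sim x z.
Proof.
  move=> H1 H2; have := little_o_add _ _ H1 H2; apply: little_o_ext; apply: ev_all => t _; ring.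
Qed.

Lemma sim_ev x y : ev (fun t => x t = y t) -> sim x y.
Proof.
  move=> H; apply: little_o_ext little_o_0; apply: ev_mono H => t _ ->; ring.
Qed.

Lemma sim_0 x y : sim x y -> x 0 = y 0.
Proof. by move=> [H _]; lra. Qed.

Lemma sim_add x x' y y' : sim x x' -> sim y y' -> sim (fun t => x t + y t) (fun t => x' t + y' t).
Proof.
  move=> H1 H2; have := little_o_add _ _ H1 H2; apply: little_o_ext; apply: ev_all => t _; ring.
Qed.

(** * Powers of t with real exponents *)

Lemma tpow_0r t : tpow t 0 = 1.
Proof. by rewrite /tpow; destruct (Req_EM_T 0 0). Qed.

Lemma tpow_0l a : a <> 0 -> tpow 0 a = 0.
Proof. rewrite /tpow => Ha; destruct (Req_EM_T a 0) => //; destruct (Rlt_dec 0 0) => //; lra. Qed.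

Lemma tpow_pos t a : 0 < t -> tpow t a = Rpower t a.
Proof.
  move=> Ht; case: (Req_EM_T a 0) => [->|N]; first by rewrite tpow_0r Rpower_O.
  by rewrite /tpow; destruct (Req_EM_T a 0) => //; destruct (Rlt_dec 0 t).
Qed.

Lemma tpow_ge0 t a : 0 <= t -> 0 <= tpow t a.
Proof.
  rewrite /tpow => Ht; destruct (Req_EM_T a 0) => /=; first lra.
  destruct (Rlt_dec 0 t) => /=; last lra.
  by apply: Rlt_le; rewrite /Rpower; apply: exp_pos.
Qed.

Lemma tpow_1r t : 0 <= t -> tpow t 1 = t.
Proof.
  move=> [H|<-]; first by rewrite tpow_pos // Rpower_1.
  by rewrite tpow_0l; lra.
Qed.

Lemma tpow_plus t a b : 0 <= t -> 0 <= a -> 0 <= b -> tpow t (a + b) = tpow t a * tpow t b.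
Proof.
  move=> [Ht|<-] Ha Hb; first by rewrite !tpow_pos // Rpower_plus.
  case: (Req_EM_T a 0) => [->|Na]; first by rewrite tpow_0r Rplus_0_l Rmult_1_l.
  rewrite !(tpow_0l a) // tpow_0l; lra.
Qed.

Lemma tpow_pow t a n : 0 <= t -> 0 <= a -> tpow t a ^ n = tpow t (INR n * a).
Proof.
  move=> Ht Ha; elim: n => [|n IH]; first by rewrite /= Rmult_0_l tpow_0r.
  rewrite -tech_pow_Rmult IH -tpow_plus // ?S_INR; last first.
    by apply: Rmult_le_pos => //; apply: pos_INR.
  congr tpow; ring.
Qed.

Lemma tpow_le1 t a : 0 <= t <= 1 -> 0 <= a -> tpow t a <= 1.
Proof.
  move=> [[H|<-] Ht] Ha; last first.
    case: (Req_EM_T a 0) => [->|Na]; first by rewrite tpow_0r; lra.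
    by rewrite tpow_0l; lra.
  have [H1|->] : t < 1 \/ t = 1 by lra.
    case: Ha => [Ha|<-]; last by rewrite tpow_0r; lra.
    rewrite tpow_pos // /Rpower -exp_0; apply/Rlt_le/exp_increasing.
    have : ln t < ln 1 by apply: ln_increasing.
    rewrite ln_1; nra.
  by rewrite tpow_pos ?/Rpower ?ln_1 ?Rmult_0_r ?exp_0; lra.
Qed.

Lemma tpow_decr t a b : 0 <= t <= 1 -> 0 <= a <= b -> tpow t b <= tpow t a.
Proof.
  move=> Ht Hab; have -> : b = a + (b - a) by ring.
  rewrite tpow_plus; try lra.
  have H1 := tpow_le1 t (b - a) Ht ltac:(lra).
  have H2 := tpow_ge0 t a ltac:(lra).
  nra.
Qed.

Lemma tpow_small a eps : 0 < a -> 0 < eps -> ev (fun t => tpow t a < eps).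
Proof.
  move=> Ha He; exists (Rpower eps (/ a)).
  split; first by rewrite /Rpower; apply: exp_pos.
  move=> t [[H|<-] Ht]; last by rewrite tpow_0l; lra.
  rewrite tpow_pos //.
  have -> : eps = Rpower (Rpower eps (/ a)) a by rewrite Rpower_mult Rinv_l ?Rpower_1; lra.
  by apply: Rlt_Rpower_l; lra.
Qed.

Lemma tpow_o c : 1 < c -> little_o (fun t => tpow t c).
Proof.
  move=> Hc; apply/little_oE => eps He.
  apply: ev_mono (tpow_small (c - 1) eps ltac:(lra) He) => t Ht H.
  have -> : c = (c - 1) + 1 by ring.
  rewrite tpow_plus; try lra.
  rewrite tpow_1r // Rabs_pos_eq; last first.
    by apply: Rmult_le_pos => //; apply: tpow_ge0.
  by apply: Rmult_le_compat_r; lra.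
Qed.

(** * Finite power sums and the maps of R_o[t] *)

(** The constant r of [poly_part] becomes a term of exponent 0, so that all terms are treated
    alike. *)
Definition ksum (l : list (R * R)) (t : R) : R :=
  fold_right (fun p acc => tpow t (fst p) * snd p + acc) 0 l.

Definition kexp_ge0 (l : list (R * R)) : Prop := forall p, In p l -> 0 <= fst p.

Lemma ksum_app l m t : ksum (app l m) t = ksum l t + ksum m t.
Proof. by elim: l => [|p l IH] /=; [ring | rewrite IH; ring]. Qed.

Lemma RoE x : Ro x <-> exists l, kexp_ge0 l /\ sim x (ksum l).
Proof.
  split.
  - move=> [r [l [Hl Ho]]]; exists ((0, r) :: List.map (fun p => (snd p, fst p)) l); split.
      move=> p [<-|] /=; first lra.
      by move=> /in_map_iff [q [<- Hq]]; move/Forall_forall: Hl; apply.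
    move: Ho; apply: little_o_ext; apply: ev_all => t _; congr (_ - _).
    rewrite /poly_part /= tpow_0r Rmult_1_l; congr (_ + _).
    by elim: l {Hl} => [|p l IH] //=; rewrite IH; ring.
  - move=> [l [Hl Ho]]; exists 0, (List.map (fun p => (snd p, fst p)) l); split.
      by apply/Forall_forall => p /in_map_iff [q [<- Hq]]; apply: Hl.
    move: Ho; apply: little_o_ext; apply: ev_all => t _; congr (_ - _).
    rewrite /poly_part /= Rplus_0_l.
    by elim: l {Hl} => [|p l IH] //=; rewrite IH; ring.
Qed.

Lemma Ro_sim x y : Ro x -> sim x y -> Ro y.
Proof.
  move=> /RoE [l [Hl H]] H'; apply/RoE; exists l; split=> //.
  apply: sim_trans H; exact: sim_sym.
Qed.

Lemma Ro_add x y : Ro x -> Ro y -> Ro (fun t => x t + y t).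
Proof.
  move=> /RoE [l [Hl H]] /RoE [m [Hm H']]; apply/RoE; exists (app l m); split.
    by move=> p /in_app_iff [/Hl|/Hm].
  have := little_o_add _ _ H H'; apply: little_o_ext; apply: ev_all => t _.
  rewrite ksum_app; ring.
Qed.

Lemma Ro_tpow c k : 0 <= c -> Ro (fun t => tpow t c * k).
Proof.
  move=> Hc; apply/RoE; exists [:: (c, k)]; split; first by move=> p [<-|[]].
  by apply: sim_ev; apply: ev_all => t _ /=; ring.
Qed.

Lemma Ro_const k : Ro (fun _ => k).
Proof.
  apply: Ro_sim (Ro_tpow 0 k (Rle_refl 0)) _; apply: sim_ev; apply: ev_all => t _.
  rewrite tpow_0r; ring.
Qed.

(** Terms of exponent 0 cancel, and on [0, 1] the smallest positive exponent dominates the others.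
    Capping it at 1 lets [Ro_holder] absorb the o(t) remainder into the same power. *)
Lemma ksum_holder l : kexp_ge0 l ->
  exists a C, 0 < a <= 1 /\ 0 <= C /\
    forall t, 0 <= t <= 1 -> Rabs (ksum l t - ksum l 0) <= C * tpow t a.
Proof.
  elim: l => [|[c k] l IH] Hl.
    exists 1, 0; split; first lra; split; first lra.
    by move=> t Ht /=; rewrite Rminus_diag Rabs_R0; lra.
  have [|a [C [Ha [HC H]]]] := IH; first by move=> p Hp; apply: Hl; right.
  have Hc : 0 <= c by apply: (Hl (c, k)); left.
  case: (Req_EM_T c 0) => [Hc0|Nc].
    exists a, C; split=> //; split=> // t Ht /=.
    rewrite Hc0 !tpow_0r; move: (H t Ht).
    by have -> : ksum l t - ksum l 0 = 1 * k + ksum l t - (1 * k + ksum l 0) by ring.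
  exists (Rmin a c), (C + Rabs k); have Hk := Rabs_pos k.
  split; first by have := Rmin_l a c; have := Rmin_pos a c; lra.
  split; first lra.
  move=> t Ht /=; rewrite (tpow_0l c) //.
  have -> : tpow t c * k + ksum l t - (0 * k + ksum l 0) = (ksum l t - ksum l 0) + tpow t c * k by ring.
  have H1 := Rabs_triang (ksum l t - ksum l 0) (tpow t c * k).
  have H2 := H t Ht.
  have H3 : Rabs (tpow t c * k) = tpow t c * Rabs k.
    by rewrite Rabs_mult (Rabs_pos_eq (tpow t c)) //; apply: tpow_ge0; lra.
  have H4 : 0 < Rmin a c by apply: Rmin_pos; lra.
  have H5 := Rmin_l a c; have H6 := Rmin_r a c.
  have H7 : tpow t c <= tpow t (Rmin a c) by apply: tpow_decr; lra.
  have H8 : tpow t a <= tpow t (Rmin a c) by apply: tpow_decr; lra.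
  nra.
Qed.

Lemma Ro_holder x : Ro x ->
  exists a C, 0 < a <= 1 /\ 0 <= C /\ ev (fun t => Rabs (x t - x 0) <= C * tpow t a).
Proof.
  move=> /RoE [l [Hl Hs]]; have [a [C [Ha [HC H]]]] := ksum_holder l Hl.
  exists a, (C + 1); split=> //; split; first lra.
  have H0 := sim_0 _ _ Hs.
  move/little_oE: Hs => /(_ 1 Rlt_0_1) Hs.
  apply: ev_mono (ev_and _ _ Hs (ev_lt 1 Rlt_0_1)) => t Ht [H1 H2].
  have H3 := H t ltac:(lra).
  have H4 : tpow t 1 <= tpow t a by apply: tpow_decr; lra.
  rewrite tpow_1r // in H4.
  have -> : x t - x 0 = (x t - ksum l t) + (ksum l t - ksum l 0) by rewrite H0; ring.
  have := Rabs_triang (x t - ksum l t) (ksum l t - ksum l 0); lra.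
Qed.

Lemma Ro_cont x d : Ro x -> 0 < d -> ev (fun t => Rabs (x t - x 0) < d).
Proof.
  move=> /Ro_holder [a [C [Ha [HC H]]]] Hd.
  have He : 0 < d / (C + 1) by apply: Rdiv_lt_0_compat; lra.
  apply: ev_mono (ev_and _ _ H (tpow_small a _ ltac:(lra) He)) => t Ht [H1 H2].
  have H3 : (C + 1) * (d / (C + 1)) = d by field; lra.
  have H4 := tpow_ge0 t a Ht. nra.
Qed.

Lemma Ro_bounded x : Ro x -> ev (fun t => Rabs (x t) <= Rabs (x 0) + 1).
Proof.
  move=> /Ro_cont /(_ Rlt_0_1); apply: ev_mono => t _ H.
  have := Rabs_triang (x t - x 0) (x 0).
  have -> : x t - x 0 + x 0 = x t by ring.
  lra.
Qed.

(** The n-th power of an increment bounded by C t^a is at most C^n t^(n a), which is o(t) as soon as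
    n > 1/a. This is what cuts off every Taylor expansion below. *)
Lemma Ro_nilpotent x : Ro x -> exists n, (0 < n)%N /\ little_o (fun t => Rabs (x t - x 0) ^ n).
Proof.
  move=> /Ro_holder [a [C [Ha [HC H]]]].
  have [n Hn] := INR_unbounded (1 / a).
  have Hna : 1 < INR n * a.
    have -> : 1 = 1 / a * a by field; lra.
    by apply: Rmult_lt_compat_r; lra.
  exists n; split.
    by case: n Hn Hna => //= _; lra.
  apply: (little_o_le _ _ (C ^ n) (tpow_o _ Hna)).
  apply: ev_mono H => t Ht H.
  rewrite Rabs_pos_eq; last by apply: pow_le; apply: Rabs_pos.
  rewrite (Rabs_pos_eq (tpow _ _)); last by apply: tpow_ge0.
  rewrite -tpow_pow //; last lra.
  rewrite -Rpow_mult_distr; apply: pow_incr; split=> //; exact: Rabs_pos.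
Qed.

(** * Smooth functions of one variable *)

Definition sm (V : R -> Prop) (a : R -> R) : Prop :=
  forall n x, V x -> ex_derive (Derive_n a n) x.

Definition near (y0 d : R) (y : R) : Prop := Rabs (y - y0) < d.

Lemma openR_near y0 d : openR (near y0 d).
Proof.
  move=> x Hx; exists (d - Rabs (x - y0)); split; first by rewrite /near in Hx; lra.
  move=> y Hy; rewrite /near; have := Rabs_triang (y - x) (x - y0).
  have -> : y - x + (x - y0) = y - y0 by ring.
  lra.
Qed.

Lemma openR_locally V x : openR V -> V x -> locally x V.
Proof. by move=> HV /HV [d [Hd H]]; exists (mkposreal d Hd) => y Hy; apply: H. Qed.

Lemma sm_mono (V W : R -> Prop) a : (forall x, W x -> V x) -> sm V a -> sm W a.
Proof. by move=> H Ha n x /H; apply: Ha. Qed.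

Lemma Derive_n_Derive a n x : Derive_n (Derive a) n x = Derive_n a (S n) x.
Proof. by rewrite (Derive_n_comp a n 1) PeanoNat.Nat.add_1_r. Qed.

Lemma sm_Derive V a : sm V a -> sm V (Derive a).
Proof.
  move=> Ha n x Hx; apply: ex_derive_ext (Ha (S n) x Hx) => y.
  by rewrite Derive_n_Derive.
Qed.

Lemma sm_is_derive V a x : sm V a -> V x -> is_derive a x (Derive a x).
Proof. by move=> Ha Hx; apply: Derive_correct; apply: (Ha 0%N). Qed.

Lemma sm_is_derive_n V a n x : sm V a -> V x -> is_derive (Derive_n a n) x (Derive_n a (S n) x).
Proof. by move=> Ha Hx; apply: Derive_correct; apply: (Ha n). Qed.

Lemma sm_ext V a b : openR V -> (forall x, V x -> a x = b x) -> sm V a -> sm V b.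
Proof.
  move=> HV E Ha n x Hx; apply: ex_derive_ext_loc (Ha n x Hx).
  apply: filter_imp (openR_locally V x HV Hx) => y Hy.
  apply: Derive_n_ext_loc; apply: filter_imp (openR_locally V y HV Hy); exact: E.
Qed.

Lemma sm_of_derive V a b : openR V -> (forall x, V x -> is_derive a x (b x)) -> sm V b -> sm V a.
Proof.
  move=> HV D Hb [|n] x Hx; first by exists (b x); apply: D.
  apply: (ex_derive_ext (Derive_n (Derive a) n)) => [y|]; first by rewrite Derive_n_Derive.
  apply: (sm_ext V b) => // y Hy; symmetry; apply: is_derive_unique; exact: D.
Qed.

Lemma sm_const V k : sm V (fun _ => k).
Proof.
  move=> [|n] x Hx; first by apply: ex_derive_const.
  apply: (ex_derive_ext (fun _ => 0)) => [y|]; first by rewrite Derive_n_const.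
  exact: ex_derive_const.
Qed.

Lemma sm_id V : openR V -> sm V (fun y => y).
Proof.
  move=> HV; apply: (sm_of_derive V _ (fun _ => 1)) => //; last exact: sm_const.
  move=> x _; exact: is_derive_id.
Qed.

Lemma sm_scal V k a : sm V a -> sm V (fun y => k * a y).
Proof.
  move=> Ha n x Hx; apply: (ex_derive_ext (fun y => k * Derive_n a n y)).
    by move=> y; rewrite Derive_n_scal_l.
  by apply: ex_derive_scal; apply: Ha.
Qed.

Lemma sm_locally V a n x : openR V -> sm V a -> V x ->
  locally x (fun y => forall k, (k <= n)%coq_nat -> ex_derive_n a k y).
Proof.
  move=> HV Ha Hx; apply: filter_imp (openR_locally V x HV Hx) => y Hy [|k] _ //=.
  exact: Ha.
Qed.

Lemma sm_plus V a b : openR V -> sm V a -> sm V b -> sm V (fun y => a y + b y).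
Proof.
  move=> HV Ha Hb n x Hx.
  apply: (ex_derive_ext_loc (fun y => Derive_n a n y + Derive_n b n y)).
    apply: filter_imp (openR_locally V x HV Hx) => y Hy.
    rewrite Derive_n_plus //; exact: (sm_locally V).
  by apply: ex_derive_plus; [apply: Ha | apply: Hb].
Qed.

Lemma ex_derive_eps_delta a x e : ex_derive a x -> 0 < e ->
  exists d, 0 < d /\ forall y, Rabs (y - x) < d -> Rabs (a y - a x) < e.
Proof.
  move=> /ex_derive_continuous H He.
  have [d Hd] : locally x (fun y => ball (a x) e (a y)).
    by apply: (H (ball (a x) e)); exists (mkposreal e He).
  exists d; split; first exact: cond_pos.
  by move=> y Hy; apply: Hd.
Qed.

(* The [G k] play the role of the successive derivatives of [G 0]. *)
Fixpoint tayl (G : nat -> R -> R) (z : R) (n : nat) (h : R) : R :=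
  match n with
  | O => 0
  | S m => tayl G z m h + G m z * h ^ m / INR (Factorial.fact m)
  end.

Lemma tayl_0 G z n : tayl G z (S n) 0 = G 0%N z.
Proof.
  elim: n => [|n IH]; first by rewrite /=; field.
  move: IH; set T := tayl G z (S n) 0 => IH.
  have -> : tayl G z (S (S n)) 0 = T + G (S n) z * 0 ^ (S n) / INR (Factorial.fact (S n)) by [].
  rewrite IH pow_i; last by lia.
  field; exact: INR_fact_neq_0.
Qed.

Lemma is_derive_tayl G z n (w : R) :
  is_derive (fun w => tayl G z (S n) (w - z)) w (tayl (fun k => G (S k)) z n (w - z)).
Proof.
  elim: n => [|n IH].
    by rewrite /=; auto_derive => //; ring.
  have -> : tayl (fun k => G (S k)) z (S n) (w - z) =
    plus (tayl (fun k => G (S k)) z n (w - z)) (G (S n) z * (w - z) ^ n / INR (Factorial.fact n)).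
    by [].
  apply: (is_derive_plus (fun w => tayl G z (S n) (w - z))
           (fun w => G (S n) z * (w - z) ^ (S n) / INR (Factorial.fact (S n)))) IH _.
  auto_derive => //.
  have -> : INR (Factorial.fact n + (n * Factorial.fact n)%coq_nat)%coq_nat =
    (INR n + 1) * INR (Factorial.fact n) by rewrite -S_INR -mult_INR.
  rewrite -[match n with O => 1 | _ => _ end]/(INR n.+1) S_INR /Rminus.
  field; split; [exact: INR_fact_neq_0 | have := pos_INR n; lra].
Qed.

(** The remainder of order n+1 vanishes at [z], and its derivative is the remainder of order n of
    the shifted family, so the mean value inequality gives the induction. The factor 1/n! is given
    up: only the power of |w - z| matters. *)
Lemma taylor_bound n : forall G z rho M,
  (forall k w, Rabs (w - z) <= rho -> is_derive (G k) w (G (S k) w)) ->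
  (forall w, Rabs (w - z) <= rho -> Rabs (G n w) <= M) ->
  forall w, Rabs (w - z) <= rho -> Rabs (G 0%N w - tayl G z n (w - z)) <= M * Rabs (w - z) ^ n.
Proof.
  elim: n => [|n IH] G z rho M HG HM w Hw.
    by rewrite /= Rminus_0_r Rmult_1_r; apply: HM.
  have IH' := IH (fun k => G (S k)) z rho M (fun k => HG (S k)) HM.
  have HM0 : 0 <= M by apply: Rle_trans (HM w Hw); apply: Rabs_pos.
  have := bounded_variation (fun w => G 0%N w - tayl G z (S n) (w - z))
    (fun w => G 1%N w - tayl (fun k => G (S k)) z n (w - z)) (M * Rabs (w - z) ^ n) z w.
  rewrite [z - z]Rminus_diag tayl_0 Rminus_diag Rminus_0_r => H.
  rewrite -tech_pow_Rmult.
  have -> : M * (Rabs (w - z) * Rabs (w - z) ^ n) = M * Rabs (w - z) ^ n * Rabs (w - z) by ring.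
  apply: H => t Ht; split.
    apply: (is_derive_minus (G 0%N) (fun w => tayl G z (S n) (w - z))); last exact: is_derive_tayl.
    by apply: HG; lra.
  apply: Rle_trans (IH' t _) _; first lra.
  apply: Rmult_le_compat_l => //; apply: pow_incr; split=> //; exact: Rabs_pos.
Qed.

(** * Calculus of [Ck] functions *)

Section Ck.
Variable d : nat.
Implicit Types (U : vec d -> Prop) (f g : vec d -> R) (x y : vec d).

Definition box x e y := forall i, Rabs (y i - x i) < e.

Lemma upd_id x i : upd x i (x i) = x.
Proof. by apply: functional_extensionality => j; rewrite /upd; case: eqP => [->|]. Qed.

Lemma upd_upd x i s t : upd (upd x i s) i t = upd x i t.
Proof. by apply: functional_extensionality => j; rewrite /upd; case: eqP. Qed.

Lemma upd_same x i s : upd x i s i = s.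
Proof. by rewrite /upd eqxx. Qed.

Lemma box_upd x i h e : 0 < e -> Rabs (h - x i) < e -> box x e (upd x i h).
Proof.
  move=> He Hh j; rewrite /upd; case: eqP => [->|_] //.
  by rewrite Rminus_diag Rabs_R0.
Qed.

Lemma openv_line U x i : openv U -> U x -> locally (x i) (fun h => U (upd x i h)).
Proof.
  move=> HU /HU [e [He H]]; exists (mkposreal e He) => h Hh; apply: H; exact: box_upd.
Qed.

Lemma Ck_contin n U f x : Ck n U f -> U x -> contin_at f x.
Proof. by case: n => [|n] [H _]; apply: H. Qed.

Lemma contin_at_ext U f g x : openv U -> U x -> (forall x, U x -> f x = g x) ->
  contin_at f x -> contin_at g x.
Proof.
  move=> HU Hx E Hc e He; have [e1 [He1 H1]] := HU x Hx; have [e2 [He2 H2]] := Hc e He.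
  exists (Rmin e1 e2); split; first exact: Rmin_pos.
  move=> y Hy; have Uy : U y by apply: H1 => i; apply: Rlt_le_trans (Hy i) (Rmin_l _ _).
  rewrite -!E //; apply: H2 => i; exact: Rlt_le_trans (Hy i) (Rmin_r _ _).
Qed.

Lemma Ck_ext n : forall U f g, openv U -> (forall x, U x -> f x = g x) -> Ck n U f -> Ck n U g.
Proof.
  elim: n => [|n IH] U f g HU E [Hc Hd].
    by split=> // x Hx; apply: (contin_at_ext U f) => //; apply: Hc.
  split; first by move=> x Hx; apply: (contin_at_ext U f) => //; apply: Hc.
  move=> i; have [Hex HCk] := Hd i.
  have El x : U x -> locally (x i) (fun h => f (upd x i h) = g (upd x i h)).
    by move=> Hx; apply: filter_imp (openv_line U x i HU Hx) => h; apply: E.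
  split=> [x Hx|]; first exact: ex_derive_ext_loc (El x Hx) (Hex x Hx).
  apply: IH HCk => // x Hx; exact: Derive_ext_loc (El x Hx).
Qed.

Lemma Ck_pred n : forall U f, Ck (S n) U f -> Ck n U f.
Proof.
  elim: n => [|n IH] U f [Hc Hd]; split=> // i.
  have [Hex HCk] := Hd i; split=> //; exact: IH.
Qed.

Lemma contin_plus f g x : contin_at f x -> contin_at g x -> contin_at (fun z => f z + g z) x.
Proof.
  move=> Hf Hg e He.
  have [e1 [He1 H1]] := Hf (e / 2) ltac:(lra); have [e2 [He2 H2]] := Hg (e / 2) ltac:(lra).
  exists (Rmin e1 e2); split; first exact: Rmin_pos.
  move=> y Hy.
  have := H1 y (fun i => Rlt_le_trans _ _ _ (Hy i) (Rmin_l _ _)).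
  have := H2 y (fun i => Rlt_le_trans _ _ _ (Hy i) (Rmin_r _ _)).
  have := Rabs_triang (f y - f x) (g y - g x).
  have -> : f y - f x + (g y - g x) = f y + g y - (f x + g x) by ring.
  lra.
Qed.

Lemma contin_mult f g x : contin_at f x -> contin_at g x -> contin_at (fun z => f z * g z) x.
Proof.
  move=> Hf Hg e He.
  set M := Rabs (f x) + Rabs (g x) + 2.
  have HM : 2 <= M by have := Rabs_pos (f x); have := Rabs_pos (g x); rewrite /M; lra.
  have He' : 0 < Rmin 1 (e / (2 * M)) by apply: Rmin_pos; [lra | apply: Rdiv_lt_0_compat; lra].
  have [e1 [He1 H1]] := Hf _ He'; have [e2 [He2 H2]] := Hg _ He'.
  exists (Rmin e1 e2); split; first exact: Rmin_pos.
  move=> y Hy.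
  have h1 := H1 y (fun i => Rlt_le_trans _ _ _ (Hy i) (Rmin_l _ _)).
  have h2 := H2 y (fun i => Rlt_le_trans _ _ _ (Hy i) (Rmin_r _ _)).
  have m1 := Rmin_l 1 (e / (2 * M)); have m2 := Rmin_r 1 (e / (2 * M)).
  have -> : f y * g y - f x * g x = (f y - f x) * g y + f x * (g y - g x) by ring.
  have hg : Rabs (g y) <= M.
    have := Rabs_triang (g y - g x) (g x).
    have -> : g y - g x + g x = g y by ring.
    have := Rabs_pos (f x); rewrite /M; lra.
  have hf : Rabs (f x) <= M - 1 by have := Rabs_pos (g x); rewrite /M; lra.
  have h3 := Rabs_triang ((f y - f x) * g y) (f x * (g y - g x)).
  rewrite !Rabs_mult in h3.
  have E : e / (2 * M) * M = e / 2 by field; lra.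
  have h4 : Rabs (f y - f x) * Rabs (g y) <= e / (2 * M) * M.
    by apply: Rmult_le_compat; try exact: Rabs_pos; lra.
  have E' : Rabs (f x) * Rabs (g y - g x) <= (M - 1) * (e / (2 * M)).
    by apply: Rmult_le_compat; try exact: Rabs_pos; lra.
  have : 0 < e / (2 * M) by lra.
  lra.
Qed.

Lemma contin_comp (a : R -> R) f x : continuous a (f x) -> contin_at f x -> contin_at (fun z => a (f z)) x.
Proof.
  move=> Ha Hf e He.
  have [d0 Hd0] : locally (f x) (fun s : R => ball (a (f x)) e (a s)).
    by apply: (Ha (ball (a (f x)) e)); exists (mkposreal e He).
  have [e1 [He1 H1]] := Hf d0 (cond_pos d0).
  by exists e1; split=> // y Hy; apply: Hd0; apply: H1.
Qed.

Lemma Ck_const n : forall U k, openv U -> Ck n U (fun _ => k).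
Proof.
  elim: n => [|n IH] U k HU; (split; first by
    move=> x _ e He; exists 1; split; [lra | move=> y _; rewrite Rminus_diag Rabs_R0]) => // i.
  split=> [x Hx|]; first exact: ex_derive_const.
  apply: (Ck_ext _ _ (fun _ => 0)) => // [x _|]; last exact: IH.
  by rewrite /partial Derive_const.
Qed.

Lemma Ck_proj n U j : openv U -> Ck n U (fun z => z j).
Proof.
  have Hc x : contin_at (fun z => z j) x by move=> e He; exists e; split=> // y; apply.
  case: n => [|n] HU; split=> // i.
  have D (x : vec d) : is_derive (fun h => upd x i h j) (x i) (if j == i then 1 else 0).
    by rewrite /upd; case: eqP => _; [apply: is_derive_id | apply: is_derive_const].
  split=> [x Hx|]; first by exists (if j == i then 1 else 0).
  apply: (Ck_ext _ _ (fun _ => if j == i then 1 else 0)) => // [x _|]; last exact: Ck_const.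
  by symmetry; apply: is_derive_unique.
Qed.

Lemma Ck_plus n : forall U f g, openv U -> Ck n U f -> Ck n U g -> Ck n U (fun z => f z + g z).
Proof.
  elim: n => [|n IH] U f g HU [fc fd] [gc gd];
    (split; first by move=> x Hx; apply: contin_plus; [apply: fc | apply: gc]) => // i.
  have [fe fp] := fd i; have [ge gp] := gd i.
  split=> [x Hx|]; first by apply: ex_derive_plus; [apply: fe | apply: ge].
  apply: (Ck_ext _ _ (fun z => partial i f z + partial i g z)) => // [x Hx|]; last exact: IH.
  by rewrite /partial Derive_plus //; [apply: fe | apply: ge].
Qed.

Lemma Ck_mult n : forall U f g, openv U -> Ck n U f -> Ck n U g -> Ck n U (fun z => f z * g z).
Proof.
  elim: n => [|n IH] U f g HU Hf Hg; have := Hf; have := Hg; move=> [gc gd] [fc fd];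
    (split; first by move=> x Hx; apply: contin_mult; [apply: fc | apply: gc]) => // i.
  have [fe fp] := fd i; have [ge gp] := gd i.
  split=> [x Hx|]; first by apply: ex_derive_mult; [apply: fe | apply: ge].
  apply: (Ck_ext _ _ (fun z => partial i f z * g z + f z * partial i g z)) => // [x Hx|].
    rewrite /partial Derive_mult ?upd_id //; [exact: fe | exact: ge].
  apply: Ck_plus => //; apply: IH => //; exact: Ck_pred.
Qed.

Lemma Ck_comp n : forall U V a f, openv U -> sm V a -> (forall x, U x -> V (f x)) ->
  Ck n U f -> Ck n U (fun z => a (f z)).
Proof.
  elim: n => [|n IH] U V a f HU Ha HV Hf; have := Hf; move=> [fc fd];
    (split; first by move=> x Hx; apply: contin_comp; [apply: ex_derive_continuous;
       apply: (Ha 0%N); apply: HV | apply: fc]) => // i.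
  have [fe fp] := fd i.
  have D x : U x -> is_derive (fun h => a (f (upd x i h))) (x i) (partial i f x * Derive a (f x)).
    move=> Hx; apply: (is_derive_comp a (fun h => f (upd x i h))).
      by rewrite upd_id; apply: (sm_is_derive V) => //; apply: HV.
    by apply: Derive_correct; apply: fe.
  split=> [x Hx|]; first by eexists; apply: D.
  apply: (Ck_ext _ _ (fun z => partial i f z * Derive a (f z))) => // [x Hx|].
    by symmetry; apply: is_derive_unique; apply: D.
  apply: Ck_mult => //; apply: (IH _ V) => //; [exact: sm_Derive | exact: Ck_pred].
Qed.

Lemma Cinf_partial U f i : Cinf U f -> Cinf U (partial i f).
Proof. by move=> H n; have [_ /(_ i) []] := H (S n). Qed.

Lemma Cinf_iter U f i n : Cinf U f -> Cinf U (iter n (partial i) f).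
Proof. by move=> H; elim: n => //= n IH; apply: Cinf_partial. Qed.

Lemma Cinf_is_derive U f x i s : Cinf U f -> U (upd x i s) ->
  is_derive (fun h => f (upd x i h)) s (partial i f (upd x i s)).
Proof.
  move=> /(_ 1%N) [_ /(_ i) [H _]] /H.
  rewrite /partial upd_same => H1; apply: is_derive_ext (Derive_correct _ _ H1) => h.
  by rewrite upd_upd.
Qed.

Lemma openv_slice U x i : openv U -> openR (fun r : R => U (upd x i r)).
Proof.
  move=> HU s Hs; have [[e He] H] := openv_line U _ i HU Hs.
  exists e; split=> // y Hy.
  by have := H y; rewrite upd_upd upd_same; apply.
Qed.

Lemma sm_slice U f x i : openv U -> Cinf U f -> sm (fun r : R => U (upd x i r)) (fun r : R => f (upd x i r)).
Proof.
  move=> HU Hf.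
  have HV := openv_slice U x i HU.
  have E n : forall r : R, U (upd x i r) ->
    Derive_n (fun r : R => f (upd x i r)) n r = iter n (partial i) f (upd x i r).
    elim: n => [|n IH] r Hr //.
    rewrite [LHS]/=; apply: is_derive_unique.
    apply: is_derive_ext_loc (Cinf_is_derive _ _ _ _ _ (Cinf_iter U f i n Hf) Hr).
    by apply: filter_imp (openR_locally _ r HV Hr) => s /IH.
  move=> n r Hr; eexists.
  apply: is_derive_ext_loc (Cinf_is_derive _ _ _ _ _ (Cinf_iter U f i n Hf) Hr).
  by apply: filter_imp (openR_locally _ r HV Hr) => s /E.
Qed.

Lemma Cinf_bound U f x : openv U -> Cinf U f -> U x ->
  exists e, 0 < e /\ forall y, box x e y -> U y /\ Rabs (f y) <= Rabs (f x) + 1.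
Proof.
  move=> HU Hf Hx; have [e1 [He1 H1]] := HU x Hx.
  have [e2 [He2 H2]] := Ck_contin _ _ _ _ (Hf 0%N) Hx 1 Rlt_0_1.
  exists (Rmin e1 e2); split; first exact: Rmin_pos.
  move=> y Hy; split; first by apply: H1 => i; apply: Rlt_le_trans (Hy i) (Rmin_l _ _).
  have := H2 y (fun i => Rlt_le_trans _ _ _ (Hy i) (Rmin_r _ _)).
  have := Rabs_triang (f y - f x) (f x).
  have -> : f y - f x + f x = f y by ring.
  lra.
Qed.

End Ck.

(** * Expansions in powers of t with smooth coefficients *)

Definition nfs (l : list (R * (R -> R))) (t y : R) : R :=
  fold_right (fun p acc => tpow t (fst p) * snd p y + acc) 0 l.

Definition good (V : R -> Prop) (l : list (R * (R -> R))) : Prop :=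
  forall p, In p l -> 0 <= fst p /\ sm V (snd p).

(** The radius [d] is chosen before [eps], and the range of t does not depend on y. This uniformity
    allows y to be replaced by a map of t that stays near [y0]. *)
Definition near_o (y0 : R) (E : R -> R -> R) : Prop :=
  exists d, 0 < d /\ forall eps, 0 < eps ->
    ev (fun t => forall y, near y0 d y -> Rabs (E t y) <= eps * t).

(** The coefficients stay smooth on the fixed set [V], while the neighbourhood on which the
    remainder is o(t) may shrink from one construction to the next. *)
Definition NF (V : R -> Prop) (y0 : R) (F : R -> R -> R) : Prop :=
  exists l, good V l /\ near_o y0 (fun t y => F t y - nfs l t y).

Lemma nfs_app l m t y : nfs (app l m) t y = nfs l t y + nfs m t y.
Proof. by elim: l => [|p l IH] /=; [ring | rewrite IH; ring]. Qed.

Lemma good_app V l m : good V l -> good V m -> good V (app l m).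
Proof. by move=> Hl Hm p /in_app_iff [/Hl|/Hm]. Qed.

Lemma good_mono (V W : R -> Prop) l : (forall x, W x -> V x) -> good V l -> good W l.
Proof. by move=> H Hl p /Hl [h1 h2]; split=> //; apply: sm_mono h2. Qed.

Lemma good_tl V p l : good V (p :: l) -> good V l.
Proof. by move=> H q Hq; apply: H; right. Qed.

Lemma near_mono y0 d d' y : d <= d' -> near y0 d y -> near y0 d' y.
Proof. rewrite /near; lra. Qed.

Lemma near_o_add y0 E E' : near_o y0 E -> near_o y0 E' -> near_o y0 (fun t y => E t y + E' t y).
Proof.
  move=> [d [Hd H]] [d' [Hd' H']]; exists (Rmin d d'); split; first exact: Rmin_pos.
  move=> eps He.
  apply: ev_mono (ev_and _ _ (H (eps / 2) ltac:(lra)) (H' (eps / 2) ltac:(lra))) => t _ [h1 h2] y Hy.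
  have := h1 y (near_mono _ _ _ _ (Rmin_l _ _) Hy).
  have := h2 y (near_mono _ _ _ _ (Rmin_r _ _) Hy).
  have := Rabs_triang (E t y) (E' t y); lra.
Qed.

Lemma near_o_le y0 E E' d C : 0 < d -> near_o y0 E ->
  ev (fun t => forall y, near y0 d y -> Rabs (E' t y) <= C * Rabs (E t y)) -> near_o y0 E'.
Proof.
  move=> Hd [d' [Hd' H]] H'; exists (Rmin d d'); split; first exact: Rmin_pos.
  move=> eps He.
  have HC : 0 < Rabs C + 1 by have := Rabs_pos C; lra.
  have He' : 0 < eps / (Rabs C + 1) by apply: Rdiv_lt_0_compat.
  apply: ev_mono (ev_and _ _ H' (H _ He')) => t Ht [h1 h2] y Hy.
  have H1 := h1 y (near_mono _ _ _ _ (Rmin_l _ _) Hy).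
  have H2 := h2 y (near_mono _ _ _ _ (Rmin_r _ _) Hy).
  have H3 : C * Rabs (E t y) <= (Rabs C + 1) * Rabs (E t y).
    by apply: Rmult_le_compat_r; [apply: Rabs_pos | have := Rle_abs C; lra].
  have H4 : (Rabs C + 1) * Rabs (E t y) <= (Rabs C + 1) * (eps / (Rabs C + 1) * t).
    by apply: Rmult_le_compat_l; lra.
  have H5 : (Rabs C + 1) * (eps / (Rabs C + 1) * t) = eps * t by field; lra.
  lra.
Qed.

Lemma near_o_little y0 w : little_o w -> near_o y0 (fun t _ => w t).
Proof.
  move=> /little_oE H; exists 1; split; first lra.
  by move=> eps /H; apply: ev_mono => t _ Ht y _.
Qed.

Lemma near_o_ext y0 E E' : near_o y0 E -> (forall t y, 0 <= t -> E t y = E' t y) -> near_o y0 E'.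
Proof.
  move=> H HE; apply: (near_o_le _ _ _ 1 1 Rlt_0_1 H); apply: ev_all => t Ht y _.
  rewrite HE //; lra.
Qed.

Lemma NF_perturb V y0 F F' : NF V y0 F -> near_o y0 (fun t y => F' t y - F t y) -> NF V y0 F'.
Proof.
  move=> [l [Hl H]] H'; exists l; split=> //.
  by apply: near_o_ext (near_o_add _ _ _ H H') _ => t y _; ring.
Qed.

Lemma NF_0 V y0 : NF V y0 (fun _ _ => 0).
Proof.
  exists nil; split=> //.
  by apply: near_o_ext (near_o_little _ _ little_o_0) _ => t y _ /=; ring.
Qed.

Lemma NF_add V y0 F G : NF V y0 F -> NF V y0 G -> NF V y0 (fun t y => F t y + G t y).
Proof.
  move=> [l [Hl H]] [m [Hm H']]; exists (app l m); split; first exact: good_app.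
  apply: near_o_ext (near_o_add _ _ _ H H') _ => t y _; rewrite nfs_app; ring.
Qed.

Lemma NF_scal V y0 F c k : 0 <= c -> NF V y0 F -> NF V y0 (fun t y => F t y * (tpow t c * k)).
Proof.
  move=> Hc [l [Hl H]].
  exists (List.map (fun p => (fst p + c, fun y => k * snd p y)) l); split.
    move=> q /in_map_iff [p [<- /Hl [h1 h2]]] /=; split; [lra | exact: sm_scal].
  apply: (near_o_le _ _ _ 1 (Rabs k) Rlt_0_1 H).
  apply: ev_mono (ev_lt 1 Rlt_0_1) => t Ht Ht1 y _.
  have -> : nfs (List.map (fun p => (fst p + c, fun y => k * snd p y)) l) t y =
            nfs l t y * (tpow t c * k).
    elim: l Hl {H} => [|p l IH] Hl /=; first ring.
    rewrite IH; last exact: good_tl Hl.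
    rewrite tpow_plus //; first ring.
    by have [] := Hl p (or_introl erefl).
  have -> : F t y * (tpow t c * k) - nfs l t y * (tpow t c * k) =
     tpow t c * (k * (F t y - nfs l t y)) by ring.
  rewrite Rabs_mult (Rabs_pos_eq (tpow t c)); last exact: tpow_ge0.
  rewrite Rabs_mult.
  have h1 := tpow_le1 t c ltac:(lra) Hc; have h2 := tpow_ge0 t c Ht.
  have h3 : 0 <= Rabs k * Rabs (F t y - nfs l t y) by apply: Rmult_le_pos; apply: Rabs_pos.
  nra.
Qed.

Lemma nfs_bounded V y0 l : V y0 -> good V l ->
  exists d M, 0 < d /\ ev (fun t => forall y, near y0 d y -> Rabs (nfs l t y) <= M).
Proof.
  move=> Hy0; elim: l => [|[c a] l IH] Hl.
    exists 1, 0; split; first lra.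
    by apply: ev_all => t _ y _ /=; rewrite Rabs_R0; lra.
  have [|d [M [Hd H]]] := IH; first exact: good_tl Hl.
  have [Hc Ha] := Hl (c, a) (or_introl erefl).
  have [d' [Hd' H']] := ex_derive_eps_delta a y0 1 (Ha 0%N y0 Hy0) Rlt_0_1.
  exists (Rmin d d'), (Rabs (a y0) + 1 + M); split; first exact: Rmin_pos.
  apply: ev_mono (ev_and _ _ H (ev_lt 1 Rlt_0_1)) => t Ht [h Ht1] y Hy /=.
  have h1 := h y (near_mono _ _ _ _ (Rmin_l _ _) Hy).
  have h2 := H' y (near_mono _ _ _ _ (Rmin_r _ _) Hy).
  have h3 := Rabs_triang (tpow t c * a y) (nfs l t y).
  have h4 := Rabs_triang (a y - a y0) (a y0).
  rewrite [a y - a y0 + a y0](_ : _ = a y) in h4; last ring.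
  rewrite Rabs_mult (Rabs_pos_eq (tpow t c)) in h3; last exact: tpow_ge0.
  simpl in Hc; have h5 := tpow_le1 t c ltac:(lra) Hc; have h6 := tpow_ge0 t c Ht.
  have h7 := Rabs_pos (a y).
  nra.
Qed.

Lemma NF_bounded V y0 F : V y0 -> NF V y0 F ->
  exists d M, 0 < d /\ ev (fun t => forall y, near y0 d y -> Rabs (F t y) <= M).
Proof.
  move=> Hy0 [l [/(nfs_bounded _ _ _ Hy0) [d [M [Hd HM]]] [d' [Hd' H]]]].
  exists (Rmin d d'), (M + 1); split; first exact: Rmin_pos.
  apply: ev_mono (ev_and _ _ HM (ev_and _ _ (H 1 Rlt_0_1) (ev_lt 1 Rlt_0_1))) => t Ht [h1 [h2 h3]] y Hy.
  have H1 := h1 y (near_mono _ _ _ _ (Rmin_l _ _) Hy).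
  have H2 := h2 y (near_mono _ _ _ _ (Rmin_r _ _) Hy).
  have := Rabs_triang (F t y - nfs l t y) (nfs l t y).
  rewrite [F t y - nfs l t y + nfs l t y](_ : _ = F t y); last ring.
  lra.
Qed.

(** The power sum in [x] only shifts exponents and scales coefficients. Its o(t) part stays o(t)
    after multiplication because an expandable [F] is bounded near [y0]. *)
Lemma NF_mul_Ro V y0 F x : V y0 -> NF V y0 F -> Ro x -> NF V y0 (fun t y => F t y * x t).
Proof.
  move=> Hy0 HF /RoE [l [Hl Hx]].
  have Hs : NF V y0 (fun t y => F t y * ksum l t).
    elim: l Hl {Hx} => [|[c k] l IH] Hl.
      apply: NF_perturb (NF_0 V y0) _.
      by apply: near_o_ext (near_o_little _ _ little_o_0) _ => t y _ /=; ring.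
    have Hc : 0 <= c by apply: (Hl (c, k)); left.
    have Hl' : kexp_ge0 l by move=> q Hq; apply: Hl; right.
    apply: NF_perturb (NF_add _ _ _ _ (NF_scal _ _ _ c k Hc HF) (IH Hl')) _.
    by apply: near_o_ext (near_o_little _ _ little_o_0) _ => t y _ /=; ring.
  apply: NF_perturb Hs _.
  have [d [M [Hd HM]]] := NF_bounded _ _ _ Hy0 HF.
  apply: (near_o_le _ _ _ d M Hd (near_o_little y0 _ Hx)).
  apply: ev_mono HM => t Ht HM y Hy.
  rewrite -Rmult_minus_distr_l Rabs_mult.
  by apply: Rmult_le_compat_r; [apply: Rabs_pos | apply: HM].
Qed.

Lemma near_refl y0 d : 0 < d -> near y0 d y0.
Proof. by rewrite /near Rminus_diag Rabs_R0. Qed.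

Lemma near_o_at y0 E : near_o y0 E -> little_o (fun t => E t y0).
Proof.
  move=> [d [Hd H]]; apply/little_oE => eps /H; apply: ev_mono => t _; apply; exact: near_refl.
Qed.

Lemma NF_Ro V y0 F : NF V y0 F -> Ro (fun t => F t y0).
Proof.
  move=> [l [Hl /near_o_at H]]; apply/RoE.
  exists (List.map (fun p => (fst p, snd p y0)) l); split.
    by move=> q /in_map_iff [p [<- /Hl []]].
  apply: little_o_ext H; apply: ev_all => t _; congr (_ - _).
  by elim: l {Hl} => [|p l IH] //=; rewrite IH.
Qed.

Lemma NF_one V y0 a : sm V a -> NF V y0 (fun _ y => a y).
Proof.
  move=> Ha; exists [:: (0, a)]; split.
    by move=> p [<-|[]] /=; split=> //; lra.
  apply: near_o_ext (near_o_little _ _ little_o_0) _ => t y _ /=; rewrite tpow_0r; ring.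
Qed.

(** Expanding the constant function 1 times [x] times [y] avoids multiplying two power sums by
    hand. *)
Lemma Ro_mul x y : Ro x -> Ro y -> Ro (fun t => x t * y t).
Proof.
  move=> Hx Hy.
  have H1 : NF (fun _ => True) 0 (fun _ _ => 1) by apply: (NF_one _ _ (fun _ => 1)); apply: sm_const.
  have H2 := NF_mul_Ro _ _ _ _ I H1 Hx.
  have H3 := NF_Ro _ _ _ (NF_mul_Ro _ _ _ _ I H2 Hy).
  by apply: Ro_sim H3 _; apply: sim_ev; apply: ev_all => t _; ring.
Qed.

Lemma Ro_pow x n : Ro x -> Ro (fun t => x t ^ n).
Proof.
  move=> Hx; elim: n => [|n IH]; first exact: Ro_const.
  exact: (Ro_mul _ _ Hx IH).
Qed.

Lemma NF_ext V y0 F F' : NF V y0 F -> (forall t y, 0 <= t -> F t y = F' t y) -> NF V y0 F'.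
Proof.
  move=> H E; apply: NF_perturb H _.
  by apply: near_o_ext (near_o_little _ _ little_o_0) _ => t y Ht; rewrite E //; ring.
Qed.

(** This is a Taylor polynomial in the increment [h t] whose coefficients depend on t and y. The
    base point 0 is a dummy, since the family passed to [tayl] ignores it. *)
Lemma NF_tayl V y0 (G : nat -> R -> R -> R) h n : V y0 -> Ro h ->
  (forall m, NF V y0 (G m)) ->
  NF V y0 (fun t y => tayl (fun m _ => G m t y) 0 n (h t)).
Proof.
  move=> Hy0 Hh HG; elim: n => [|n IH]; first exact: NF_0.
  have H := NF_mul_Ro _ _ _ _ Hy0 (HG n) (Ro_mul _ _ (Ro_pow _ n Hh) (Ro_const (/ INR (Factorial.fact n)))).
  apply: NF_ext (NF_add _ _ _ _ IH H) _ => t y _ /=.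
  by rewrite /Rdiv; ring.
Qed.

(** * Expansion of a smooth function in its Fermat parameters *)

Lemma vcons0 {T} {n} (y : T) (q : 'I_n -> T) : vcons y q ord0 = y.
Proof. by rewrite /vcons unlift_none. Qed.

Lemma vconsS {T} {n} (y : T) (q : 'I_n -> T) i : vcons y q (lift ord0 i) = q i.
Proof. by rewrite /vcons liftK. Qed.

Lemma vec_split n (P : 'I_n.+1 -> Prop) : P ord0 -> (forall i, P (lift ord0 i)) -> forall j, P j.
Proof. by move=> H0 HS j; case: (unliftP ord0 j) => [i ->|->]. Qed.

Lemma In_enum n (k : 'I_n) : In k (enum 'I_n).
Proof.
  have := mem_enum 'I_n k.
  by elim: (enum _) => //= a l IH; rewrite in_cons => /orP [/eqP ->|/IH]; [left | right].
Qed.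

Section Expand.
Variables (pd : nat) (x : 'I_pd -> R -> R) (U : vec pd.+1 -> Prop) (y0 : R).
Hypotheses (HU : openv U) (Hx : forall i, Ro (x i)) (Hy0 : U (vcons y0 (fun i => x i 0))).

(* Only the parameters in [L] vary with [t]; the others are frozen at their standard parts. *)
Let w (L : seq 'I_pd) (t y : R) : vec pd.+1 :=
  vcons y (fun i => if i \in L then x i t else x i 0).

Lemma upd_vcons0 (y s : R) (q : vec pd) : upd (vcons y q) ord0 s = vcons s q.
Proof.
  apply: functional_extensionality; apply: vec_split; first by rewrite upd_same vcons0.
  by move=> i; rewrite /upd /= !vconsS.
Qed.

Lemma upd_w i L t y : upd (w L t y) (lift ord0 i) (x i t) = w (i :: L) t y.
Proof.
  apply: functional_extensionality; apply: vec_split; first by rewrite /upd /w /= !vcons0.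
  move=> j; rewrite /upd /w (inj_eq lift_inj) !vconsS in_cons.
  by case: eqP => [->|].
Qed.

Lemma w_box e L : 0 < e -> ev (fun t => forall y, near y0 e y -> box pd.+1 (vcons y0 (fun i => x i 0)) e (w L t y)).
Proof.
  move=> He.
  have H : ev (fun t => forall i, In i (enum 'I_pd) -> Rabs (x i t - x i 0) < e).
    by apply: ev_list => i _; apply: Ro_cont.
  apply: ev_mono H => t _ H y Hy; apply: vec_split; first by rewrite /w !vcons0.
  move=> i; rewrite /w !vconsS; case: ifP => _; last by rewrite Rminus_diag Rabs_R0.
  by apply: H; apply: In_enum.
Qed.

(** Freeing one more parameter is a Taylor expansion in its increment. The coefficients are iterated
    partials of [g] with that parameter still frozen, which is why the induction is over all [g];
    the remainder is o(t) by [Ro_nilpotent]. *)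
Lemma expand_partial L : forall g, Cinf U g ->
  NF (fun y => U (vcons y (fun i => x i 0))) y0 (fun t y => g (w L t y)).
Proof.
  elim: L => [|i L IH] g Hg.
    apply: (NF_one _ _ (fun y => g (vcons y (fun i => x i 0)))).
    (* The leading 0 is a placeholder that [upd] overwrites. *)
    have := sm_slice _ _ g (vcons 0 (fun i => x i 0)) ord0 HU Hg.
    have -> : (fun r => U (upd (vcons 0 (fun i : 'I_pd => x i 0)) ord0 r)) =
              (fun r => U (vcons r (fun i : 'I_pd => x i 0))).
      by apply: functional_extensionality => r; rewrite upd_vcons0.
    have -> // : (fun r => g (upd (vcons 0 (fun i : 'I_pd => x i 0)) ord0 r)) =
              (fun r => g (vcons r (fun i : 'I_pd => x i 0))).
    by apply: functional_extensionality => r; rewrite upd_vcons0.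
  (* A repeated parameter is already free and [w] does not change. Otherwise it still sits at its
     standard part, the base point of the Taylor expansion. *)
  case Hi : (i \in L).
    apply: NF_ext (IH g Hg) _ => t y _; congr g; rewrite /w; congr vcons.
    apply: functional_extensionality => j; rewrite in_cons.
    by case: (j =P i) => [->|] //=; rewrite Hi.
  set j := lift ord0 i.
  have [n [Hn0 Hn]] := Ro_nilpotent _ (Hx i).
  have [e [He Hbox]] := Cinf_bound _ U _ _ HU (Cinf_iter _ U g j n Hg) Hy0.
  set M := _ + 1 in Hbox.
  have Hh : Ro (fun t => x i t - x i 0) by apply: Ro_add => //; apply: Ro_const.
  have HT := NF_tayl _ y0 (fun m t y => iter m (partial j) g (w L t y)) _ n Hy0 Hh
    (fun m => IH _ (Cinf_iter _ U g j m Hg)).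
  apply: NF_perturb HT _.
  apply: (near_o_le _ _ _ e M He (near_o_little y0 _ Hn)).
  apply: ev_mono (ev_and _ _ (w_box e L He) (Ro_cont _ e (Hx i) He)) => t Ht [Hw Hxi] y Hy.
  have Hwi : w L t y j = x i 0 by rewrite /w vconsS Hi.
  have Hupd : upd (w L t y) j (x i 0) = w L t y by rewrite -Hwi upd_id.
  have Hb s : Rabs (s - x i 0) <= Rabs (x i t - x i 0) ->
     box pd.+1 (vcons y0 (fun i => x i 0)) e (upd (w L t y) j s).
    move=> Hs k; have := Hw y Hy k; rewrite /upd; case: eqP => [->|_] // _.
    by rewrite vconsS; lra.
  have := taylor_bound n (fun k s => iter k (partial j) g (upd (w L t y) j s)) (x i 0)
    (Rabs (x i t - x i 0)) M _ _ (x i t) (Rle_refl _).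
  rewrite upd_w (Rabs_pos_eq (_ ^ _)); last by apply: pow_le; apply: Rabs_pos.
  have -> : tayl (fun k s => iter k (partial j) g (upd (w L t y) j s)) (x i 0) n (x i t - x i 0) =
            tayl (fun m _ => iter m (partial j) g (w L t y)) 0 n (x i t - x i 0).
    elim: (n) => [|k IHk] //=.
    by rewrite IHk Hupd.
  apply.
    by move=> k s Hs; apply: (Cinf_is_derive _ U); [apply: Cinf_iter | have [] := Hbox _ (Hb s Hs)].
  by move=> s Hs; have [] := Hbox _ (Hb s Hs).
Qed.

Lemma expand g : Cinf U g ->
  NF (fun y => U (vcons y (fun i => x i 0))) y0 (fun t y => g (vcons y (fun i => x i t))).
Proof.
  move=> /(expand_partial (enum 'I_pd)) H; apply: NF_ext H _ => t y _; rewrite /w; congr g.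
  by congr vcons; apply: functional_extensionality => i; rewrite mem_enum.
Qed.

End Expand.

(** * Fermat reals and normal forms *)

Lemma is_rep_repr X : is_rep X (repr X).
Proof. by rewrite /repr; case: constructive_indefinite_description. Qed.

Lemma is_repP X x : is_rep X x <-> Ro x /\ sim (repr X) x.
Proof.
  have := is_rep_repr X; case: X => S [x0 [Hx0 HS]]; rewrite /is_rep /=.
  set r := repr _ => /HS [Hr Hs]; split.
    by move=> /HS [H1 H2]; split=> //; apply: sim_trans H2; apply: sim_sym.
  by move=> [H1 H2]; apply/HS; split=> //; apply: sim_trans H2.
Qed.

Lemma Ro_repr X : Ro (repr X).
Proof. by have /is_repP [] := is_rep_repr X. Qed.

Lemma FR_eq X Y : sim (repr X) (repr Y) -> X = Y.
Proof.
  move=> H.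
  have E : proj1_sig X = proj1_sig Y.
    apply: functional_extensionality => x; apply: propositional_extensionality.
    rewrite -[proj1_sig X x]/(is_rep X x) -[proj1_sig Y x]/(is_rep Y x) !is_repP.
    split=> -[H1 H2]; split=> //; last exact: sim_trans H H2.
    by apply: sim_trans H2; apply: sim_sym.
  case: X Y E {H} => [S HS] [S' HS'] /= E; subst S'.
  by rewrite (proof_irrelevance _ HS HS').
Qed.

Lemma repr_cls x : Ro x -> sim (repr (cls x)) x.
Proof.
  move=> Hx.
  have /is_repP [] // : is_rep (cls x) x.
  rewrite /cls; case: excluded_middle_informative => // H.
  by rewrite /is_rep /=; split=> //; apply: sim_refl.
Qed.

Lemma cls_eq x y : Ro x -> sim x y -> cls x = cls y.
Proof.
  move=> Hx Hs; have Hy := Ro_sim _ _ Hx Hs; apply: FR_eq.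
  apply: sim_trans (repr_cls _ Hx) _; apply: sim_trans Hs _; apply: sim_sym; exact: repr_cls.
Qed.

Lemma cls_repr X : cls (repr X) = X.
Proof. by apply: FR_eq; apply: repr_cls; apply: Ro_repr. Qed.

Lemma cls_inj x y : Ro x -> Ro y -> cls x = cls y -> sim x y.
Proof.
  move=> Hx Hy E; apply: sim_trans (repr_cls _ Hy); rewrite -E; apply: sim_sym; exact: repr_cls.
Qed.

Lemma std_cls x : Ro x -> std (cls x) = x 0.
Proof. by move=> /repr_cls /sim_0. Qed.

Lemma sim_mul x x' y y' : Ro x -> Ro y' -> sim x x' -> sim y y' ->
  sim (fun t => x t * y t) (fun t => x' t * y' t).
Proof.
  move=> Hx Hy' Hxx Hyy.
  apply: (sim_trans _ (fun t => x t * y' t)).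
    have := little_o_scal _ _ _ (Ro_bounded _ Hx) Hyy.
    by apply: little_o_ext; apply: ev_all => t _; ring.
  have := little_o_scal _ _ _ (Ro_bounded _ Hy') Hxx.
  by apply: little_o_ext; apply: ev_all => t _; ring.
Qed.

(** This is [expand] with [x] as the only parameter and an idle variable y, set to 0. *)
Lemma Ro_comp V a x : openR V -> sm V a -> Ro x -> V (x 0) -> Ro (fun t => a (x t)).
Proof.
  move=> HV Ha Hx H0.
  pose U := fun z : vec 2 => V (z (lift ord0 ord0)).
  have HU : openv U.
    move=> z /HV [e [He H]]; exists e; split=> // z' Hz; exact: H.
  have HE := expand 1 (fun _ => x) U 0 HU (fun _ => Hx).
  have H0' : U (vcons 0 (fun => x 0)) by rewrite /U vconsS.
  have /NF_Ro := HE H0' _ (fun n => Ck_comp _ n U V a _ HU Ha (fun z h => h) (Ck_proj _ n U (lift ord0 ord0) HU)).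
  by move=> H; apply: Ro_sim H _; apply: sim_ev; apply: ev_all => t _; rewrite vconsS.
Qed.

(** The derivative of [a] is bounded near [x 0], so [a] is Lipschitz there and preserves o(t)
    differences. *)
Lemma sim_comp V a x x' : openR V -> sm V a -> Ro x -> V (x 0) -> sim x x' ->
  sim (fun t => a (x t)) (fun t => a (x' t)).
Proof.
  move=> HV Ha Hx H0 Hs.
  have Hx' := Ro_sim _ _ Hx Hs; have E0 := sim_0 _ _ Hs.
  have [e1 [He1 H1]] := HV _ H0.
  have [e2 [He2 H2]] := ex_derive_eps_delta _ _ 1 (Ha 1%N _ H0) Rlt_0_1.
  set M := Rabs (Derive a (x 0)) + 1.
  set e := Rmin e1 e2; have He : 0 < e by apply: Rmin_pos.
  apply: (little_o_le _ _ M Hs).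
  (* With both maps within e/4 of [x 0], a point no farther from [x t] than [x' t] is lies within
     e/2 + e/4 < e of [x 0]. *)
  apply: ev_mono (ev_and _ _ (Ro_cont _ (e / 4) Hx ltac:(lra)) (Ro_cont _ (e / 4) Hx' ltac:(lra))).
  move=> t _ [h1 h2]; rewrite -E0 in h2.
  rewrite -Rabs_Ropp -(Rabs_Ropp (x t - _)) !Ropp_minus_distr.
  apply: (bounded_variation a (Derive a)) => s Hs'.
  have Hn : Rabs (s - x 0) < e.
    have := Rabs_triang (s - x t) (x t - x 0).
    have := Rabs_triang (x' t - x 0) (x 0 - x t).
    rewrite (Rabs_minus_sym (x 0)).
    have -> : x' t - x 0 + (x 0 - x t) = x' t - x t by ring.
    have -> : s - x t + (x t - x 0) = s - x 0 by ring.
    lra.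
  split.
    by apply: (sm_is_derive V) => //; apply: H1; apply: Rlt_le_trans Hn (Rmin_l _ _).
  have := H2 s (Rlt_le_trans _ _ _ Hn (Rmin_r _ _)).
  have := Rabs_triang (Derive a s - Derive a (x 0)) (Derive a (x 0)).
  have -> : Derive a s - Derive a (x 0) + Derive a (x 0) = Derive a s by ring.
  rewrite /= /M; change (Derive (fun x => a x)) with (Derive a); lra.
Qed.

Lemma Ro_nfs V l x : openR V -> good V l -> Ro x -> V (x 0) -> Ro (fun t => nfs l t (x t)).
Proof.
  move=> HV Hl Hx H0; elim: l Hl => [|[c a] l IH] Hl; first exact: Ro_const.
  have [Hc Ha] := Hl _ (or_introl erefl).
  apply: Ro_add; last by apply: IH; apply: good_tl Hl.
  apply: Ro_mul; last exact: (Ro_comp V).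
  apply: Ro_sim (Ro_tpow c 1 Hc) _; apply: sim_ev; apply: ev_all => t _ /=; ring.
Qed.

Lemma Ro_tpow1 c : 0 <= c -> Ro (fun t => tpow t c).
Proof.
  move=> Hc; apply: Ro_sim (Ro_tpow c 1 Hc) _; apply: sim_ev; apply: ev_all => t _; ring.
Qed.

Lemma sim_nfs V l x x' : openR V -> good V l -> Ro x -> V (x 0) -> sim x x' ->
  sim (fun t => nfs l t (x t)) (fun t => nfs l t (x' t)).
Proof.
  move=> HV Hl Hx H0 Hs; elim: l Hl => [|[c a] l IH] Hl; first exact: sim_refl.
  have [Hc Ha] := Hl _ (or_introl erefl).
  apply: sim_add; last by apply: IH; apply: good_tl Hl.
  apply: sim_mul; [exact: Ro_tpow1 | | exact: sim_refl | exact: (sim_comp V)].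
  apply: (Ro_comp V) => //; first exact: Ro_sim Hx Hs.
  by rewrite -(sim_0 _ _ Hs).
Qed.

(** * Normal forms as functions on Fermat reals, and their termwise derivatives and primitives *)

Definition nf (l : list (R * (R -> R))) (X : FR) : FR := cls (fun t => nfs l t (repr X t)).

Definition dl (l : list (R * (R -> R))) : list (R * (R -> R)) :=
  List.map (fun p => (fst p, Derive (snd p))) l.

Lemma good_dl V l : good V l -> good V (dl l).
Proof. by move=> Hl q /in_map_iff [p [<- /Hl [h1 h2]]] /=; split=> //; apply: sm_Derive. Qed.

Lemma nf_sim V l x : openR V -> good V l -> Ro x -> V (x 0) ->
  nf l (cls x) = cls (fun t => nfs l t (x t)).
Proof.
  move=> HV Hl Hx H0; symmetry; apply: cls_eq; first exact: (Ro_nfs V).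
  by apply: (sim_nfs V) => //; apply: sim_sym; apply: repr_cls.
Qed.

Lemma repr_vcons n (X : FR) (p : 'I_n -> FR) t :
  (fun i => repr (vcons X p i) t) = vcons (repr X t) (fun i => repr (p i) t).
Proof.
  apply: functional_extensionality; apply: vec_split; first by rewrite !vcons0.
  by move=> i; rewrite !vconsS.
Qed.

Lemma near_between y0 d y s : near y0 d y -> Rabs (s - y0) <= Rabs (y - y0) -> near y0 d s.
Proof. rewrite /near; lra. Qed.

Lemma RInt_is_derive V a y0 d : sm V a -> (forall y, near y0 d y -> V y) ->
  forall y, near y0 d y -> is_derive (fun y => RInt a y0 y) y (a y).
Proof.
  move=> Ha HV y Hy.
  have Hc s : near y0 d s -> continuous a s.
    by move=> Hs; apply: ex_derive_continuous; apply: (Ha 0%N); apply: HV.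
  apply: (is_derive_RInt a _ y0); last exact: Hc.
  apply: filter_imp (openR_locally _ y (openR_near y0 d) Hy) => z Hz.
  apply: RInt_correct; apply: ex_RInt_continuous => s Hs.
  apply: Hc; apply: near_between Hz _.
  move: Hs; rewrite /Rmin /Rmax; case: Rle_dec => _ Hs.
    by rewrite !Rabs_pos_eq; lra.
  by rewrite !Rabs_left1; lra.
Qed.

(** All these primitives vanish at [y0], so the integration constant, itself a power sum in t, can
    be supplied separately by [consts]. *)
Definition prims (y0 : R) (l : list (R * (R -> R))) : list (R * (R -> R)) :=
  List.map (fun p => (fst p, fun y => RInt (snd p) y0 y)) l.

Definition consts (l : list (R * R)) : list (R * (R -> R)) :=
  List.map (fun p => (fst p, fun _ => snd p)) l.

Lemma good_prims y0 d l : good (near y0 d) l -> good (near y0 d) (prims y0 l).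
Proof.
  move=> Hl q /in_map_iff [p [<- /Hl [h1 h2]]] /=; split=> //.
  apply: (sm_of_derive _ _ (snd p)) => //; first exact: openR_near.
  exact: (RInt_is_derive (near y0 d)).
Qed.

Lemma good_consts V l : kexp_ge0 l -> good V (consts l).
Proof. by move=> Hl q /in_map_iff [p [<- /Hl h1]] /=; split=> //; apply: sm_const. Qed.

Lemma nfs_consts l t y : nfs (consts l) t y = ksum l t.
Proof. by elim: l => //= p l ->. Qed.

Lemma nfs_prims_0 y0 l t : nfs (prims y0 l) t y0 = 0.
Proof.
  elim: l => //= p l ->.
  have -> : RInt (snd p) y0 y0 = 0 by apply: RInt_point.
  ring.
Qed.

Lemma nfs_is_derive V l t y : good V l -> V y -> is_derive (nfs l t) y (nfs (dl l) t y).
Proof.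
  move=> Hl Hy; elim: l Hl => [|[c a] l IH] Hl /=; first exact: is_derive_const.
  have [Hc Ha] := Hl _ (or_introl erefl).
  apply: (is_derive_plus (fun y => tpow t c * a y) (nfs l t)); last first.
    by apply: IH; apply: good_tl Hl.
  by apply: is_derive_scal; apply: (sm_is_derive V).
Qed.

Lemma nfs_dl_prims y0 d l t y : good (near y0 d) l -> near y0 d y -> nfs (dl (prims y0 l)) t y = nfs l t y.
Proof.
  move=> Hl Hy; elim: l Hl => [|[c a] l IH] Hl //=.
  have [Hc Ha] := Hl _ (or_introl erefl).
  rewrite IH; last exact: good_tl Hl.
  by rewrite (is_derive_unique _ _ _ (RInt_is_derive (near y0 d) a y0 d Ha (fun _ h => h) y Hy)).
Qed.

Lemma nfs_dl_consts l t y : nfs (dl (consts l)) t y = 0.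
Proof. by elim: l => //= p l ->; rewrite Derive_const; ring. Qed.

Lemma dl_app l m : dl (app l m) = app (dl l) (dl m).
Proof. exact: List.map_app. Qed.

Lemma ev_near X y0 d : near y0 d (std X) -> ev (fun t => near y0 d (repr X t)).
Proof.
  move=> H; have Hd : 0 < d - Rabs (std X - y0) by move: H; rewrite /near; lra.
  apply: ev_mono (Ro_cont _ _ (Ro_repr X) Hd) => t _; rewrite -/(std X) /near.
  have := Rabs_triang (repr X t - std X) (std X - y0).
  have -> : repr X t - std X + (std X - y0) = repr X t - y0 by ring.
  lra.
Qed.

(** The bound is uniform in y, and [repr X t] stays near [y0] for small t, so it may be taken for
    y. *)
Lemma near_o_cls l y0 d x X : good (near y0 d) l -> near y0 d (std X) ->
  (forall eps, 0 < eps -> ev (fun t => forall y, near y0 d y -> Rabs (x t y - nfs l t y) <= eps * t)) ->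
  cls (fun t => x t (repr X t)) = nf l X.
Proof.
  move=> Hl HX H; symmetry; apply: cls_eq.
    exact: (Ro_nfs _ _ _ (openR_near y0 d) Hl (Ro_repr X) HX).
  apply: sim_sym; apply/little_oE => eps /H He.
  by apply: ev_mono (ev_and _ _ He (ev_near _ _ _ HX)) => t _ [h1 h2]; apply: h1.
Qed.

Lemma ext_nf V pd (P : vec pd -> Prop) (p : 'I_pd -> FR) (alpha : vec pd.+1 -> R) y0 :
  openR V -> V y0 -> openv P -> P (fun i => std (p i)) ->
  Cinf (fun z : vec pd.+1 => V (z ord0) /\ P (fun j => z (lift ord0 j))) alpha ->
  exists d l, 0 < d /\ (forall y, near y0 d y -> V y) /\ good (near y0 d) l /\
    forall X, near y0 d (std X) ->
      ext alpha (vcons X p) = nf l X /\ ext (partial ord0 alpha) (vcons X p) = nf (dl l) X.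
Proof.
  move=> HV HVy HP HPp Ha.
  set U := fun z : vec pd.+1 => _ in Ha.
  have HU : openv U.
    move=> z [/HV [e1 [He1 H1]] /HP [e2 [He2 H2]]].
    exists (Rmin e1 e2); split; first exact: Rmin_pos.
    move=> z' Hz; split; first by apply: H1; apply: Rlt_le_trans (Hz _) (Rmin_l _ _).
    by apply: H2 => i; apply: Rlt_le_trans (Hz _) (Rmin_r _ _).
  pose x i := repr (p i).
  have Uvc y : V y -> U (vcons y (fun i => x i 0)).
    move=> Hy; split; rewrite ?vcons0 //.
    have -> // : (fun j => vcons y (fun i => x i 0) (lift ord0 j)) = (fun i => std (p i)).
    by apply: functional_extensionality => j; rewrite vconsS.
  have HE := expand pd x U y0 HU (fun i => Ro_repr (p i)) (Uvc y0 HVy).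
  (* The normal form of [alpha] is obtained by integrating that of its y-derivative, so
     that termwise differentiation is correct and no Schwarz theorem is needed. *)
  have [l0 [Hl0 /near_o_at H0]] := HE _ Ha.
  have [l1 [Hl1 [d1 [Hd1 H1]]]] := HE _ (Cinf_partial _ U alpha ord0 Ha).
  have [d2 [Hd2 H2]] := HV _ HVy.
  set d := Rmin d1 d2; have Hd : 0 < d by apply: Rmin_pos.
  have HdV y : near y0 d y -> V y.
    by move=> Hy; apply: H2; apply: Rlt_le_trans Hy (Rmin_r _ _).
  have Hl1d : good (near y0 d) l1 by apply: good_mono Hl1 => y /HdV /Uvc.
  (* The integration constant is the expansion of [alpha] at the single point [y0]. *)
  pose k0 := List.map (fun q => (fst q, snd q y0)) l0.
  have Hk0 : kexp_ge0 k0 by move=> q /in_map_iff [r [<- /Hl0 []]].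
  pose l := app (prims y0 l1) (consts k0).
  have Hl : good (near y0 d) l by apply: good_app; [apply: good_prims | apply: good_consts].
  have Hdl t y : near y0 d y -> nfs (dl l) t y = nfs l1 t y.
    by move=> Hy; rewrite dl_app nfs_app (nfs_dl_prims _ d) // nfs_dl_consts; ring.
  have HPt : ev (fun t => P (fun i => x i t)).
    have [e [He H]] := HP _ HPp.
    have Hev : ev (fun t => forall i, In i (enum 'I_pd) -> Rabs (x i t - x i 0) < e).
      by apply: ev_list => i _; apply: Ro_cont => //; apply: Ro_repr.
    apply: ev_mono Hev => t _ Ht; apply: H => i; apply: Ht; exact: In_enum.
  have H1d eps : 0 < eps -> ev (fun t => forall y, near y0 d y ->
      Rabs (partial ord0 alpha (vcons y (fun i => x i t)) - nfs (dl l) t y) <= eps * t).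
    move=> /H1; apply: ev_mono => t _ Ht y Hy; rewrite Hdl //; apply: Ht.
    exact: near_mono (Rmin_l _ _) Hy.
  exists d, l; split=> //; split=> //; split=> // X HX.
  rewrite /ext; split.
  - have -> : (fun t => alpha (fun i => repr (vcons X p i) t)) =
              (fun t => alpha (vcons (repr X t) (fun i => x i t))).
      by apply: functional_extensionality => t; rewrite repr_vcons.
    apply: (near_o_cls l y0 d (fun t y => alpha (vcons y (fun i => x i t)))) => // eps He.
    have /little_oE H0' := H0.
    (* The error [E] is at most (eps/2) t at [y0], and its y-derivative is at most (eps/2/d) t. Over
       a distance below d this adds at most another (eps/2) t. *)
    have He' : 0 < eps / 2 / d by apply: Rdiv_lt_0_compat; lra.
    apply: ev_mono (ev_and _ _ (H0' (eps / 2) ltac:(lra)) (ev_and _ _ HPt (H1d _ He'))).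
    move=> t Ht [h0 [hP h1]] y Hy.
    set E := fun y => alpha (vcons y (fun i => x i t)) - nfs l t y.
    have hE0 : Rabs (E y0) <= eps / 2 * t.
      have -> : E y0 = alpha (vcons y0 (fun i => x i t)) - nfs l0 t y0; last exact: h0.
      rewrite /E nfs_app nfs_prims_0 nfs_consts Rplus_0_l; congr (_ - _).
      by rewrite /k0; elim: (l0) => //= q s ->.
    have hE : Rabs (E y - E y0) <= eps / 2 / d * t * Rabs (y - y0).
      apply: (bounded_variation E (fun y => partial ord0 alpha (vcons y (fun i => x i t)) - nfs (dl l) t y)).
      move=> s Hs; have Hsn := near_between _ _ _ _ Hy Hs.
      split; last exact: h1.
      apply: (is_derive_minus (fun y => alpha (vcons y (fun i => x i t))) (nfs l t)).
        have HUs : U (upd (vcons 0 (fun i => x i t)) ord0 s).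
          rewrite upd_vcons0; split; rewrite ?vcons0; first exact: HdV.
          have -> // : (fun j => vcons s (fun i => x i t) (lift ord0 j)) = (fun i => x i t).
          by apply: functional_extensionality => j; rewrite vconsS.
        have := Cinf_is_derive _ U alpha _ ord0 s Ha HUs.
        rewrite upd_vcons0; apply: is_derive_ext => r; by rewrite upd_vcons0.
      exact: (nfs_is_derive (near y0 d)).
    have := Rabs_triang (E y - E y0) (E y0).
    have -> : E y - E y0 + E y0 = E y by ring.
    have h3 : eps / 2 / d * t * Rabs (y - y0) <= eps / 2 / d * t * d.
      apply: Rmult_le_compat_l; first by apply: Rmult_le_pos; lra.
      by move: Hy; rewrite /near; lra.
    have h4 : eps / 2 / d * t * d = eps / 2 * t by field; lra.
    rewrite -/(E y); lra.
  - have -> : (fun t => partial ord0 alpha (fun i => repr (vcons X p i) t)) =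
              (fun t => partial ord0 alpha (vcons (repr X t) (fun i => x i t))).
      by apply: functional_extensionality => t; rewrite repr_vcons.
    apply: (near_o_cls (dl l) y0 d (fun t y => partial ord0 alpha (vcons y (fun i => x i t)))) => //.
    exact: good_dl.
Qed.

(** * Composition of normal forms and the chain rule *)

Definition gsum {I} (s : list I) (f : I -> R) : R := fold_right (fun i acc => f i + acc) 0 s.

Lemma gsum_ext {I} (s : list I) f g : (forall i, f i = g i) -> gsum s f = gsum s g.
Proof. by move=> E; elim: s => //= i s ->; rewrite E. Qed.

Lemma nfs_nth d m t y :
  nfs m t y = gsum (enum 'I_(size m)) (fun j => tpow t (fst (nth d m j)) * snd (nth d m j) y).
Proof.
  pose f (p : R * (R -> R)) := tpow t (fst p) * snd p y.
  have -> : gsum (enum 'I_(size m)) (fun j => f (nth d m j)) =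
            gsum (map (nth d m) (map val (enum 'I_(size m)))) f.
    by elim: (enum _) => //= j s ->.
  rewrite val_enum_ord -/(mkseq (nth d m) (size m)) mkseq_nth.
  by elim: (m) => //= p s ->.
Qed.

(** Indexing the terms by ordinals lets their powers of t become coordinates of a parameter
    vector. *)
Lemma nfs_ord V l : good V l ->
  exists (c : 'I_(size l) -> R) (a : 'I_(size l) -> R -> R),
    (forall i, 0 <= c i /\ sm V (a i)) /\
    (forall t y, nfs l t y = gsum (enum 'I_(size l)) (fun i => tpow t (c i) * a i y)) /\
    (forall t y, nfs (dl l) t y = gsum (enum 'I_(size l)) (fun i => tpow t (c i) * Derive (a i) y)).
Proof.
  move=> Hl; pose d := (0, fun _ : R => 0).
  exists (fun i => fst (nth d l i)), (fun i => snd (nth d l i)); split; last split.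
  - move=> [i Hi] /=; apply: Hl; elim: l i Hi => //= p l IH [|i] Hi; first by left.
    by right; apply: IH.
  - by move=> t y; apply: nfs_nth.
  - move=> t y; pose f (p : R * (R -> R)) := tpow t (fst p) * Derive (snd p) y.
    have -> : gsum (enum 'I_(size l)) (fun j => f (nth d l j)) =
              gsum (map (nth d l) (map val (enum 'I_(size l)))) f.
      by elim: (enum _) => //= j s ->.
    rewrite val_enum_ord -/(mkseq (nth d l) (size l)) mkseq_nth.
    by elim: (l) => //= p s ->.
Qed.

Lemma Ck_gsum {d I} n (U : vec d -> Prop) (s : list I) (f : I -> vec d -> R) :
  openv U -> (forall i, Ck n U (f i)) -> Ck n U (fun z => gsum s (fun i => f i z)).
Proof.
  move=> HU Hf; elim: s => [|i s IH]; first exact: Ck_const.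
  exact: Ck_plus.
Qed.

Lemma is_derive_gsum {I} (s : list I) (f g : I -> R -> R) y :
  (forall i, is_derive (f i) y (g i y)) ->
  is_derive (fun y => gsum s (fun i => f i y)) y (gsum s (fun i => g i y)).
Proof.
  move=> H; elim: s => [|i s IH]; first exact: is_derive_const.
  exact: (is_derive_plus (f i) (fun y => gsum s (fun i => f i y))).
Qed.

Lemma gsum_mulr {I} (s : list I) f k : gsum s (fun i => f i * k) = gsum s f * k.
Proof. by elim: s => [|i s /= ->] /=; ring. Qed.

Lemma sim_gsum {I} (s : list I) (f g : I -> R -> R) : (forall i, sim (f i) (g i)) ->
  sim (fun t => gsum s (fun i => f i t)) (fun t => gsum s (fun i => g i t)).
Proof.
  move=> H; elim: s => [|i s IH]; first exact: sim_refl.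
  exact: (sim_add (f i) (g i)).
Qed.

Lemma sim_eq x y : (forall t, x t = y t) -> sim x y.
Proof. by move=> E; apply: sim_ev; apply: ev_all => t _. Qed.

(* The parameters are the powers of t occurring in [l] and [m]. *)
Lemma comp_rep V W l m (s0 : R) : openR V -> openR W -> good V l -> good W m ->
  W s0 -> V (nfs m 0 s0) ->
  exists V' pd P p alpha, openR V' /\ V' s0 /\ openv P /\ P (fun i => std (p i)) /\
    Cinf (fun z : vec pd.+1 => V' (z ord0) /\ P (fun j => z (lift ord0 j))) alpha /\
    forall X, V' (std X) ->
      W (std X) /\ V (nfs m 0 (std X)) /\
      ext alpha (vcons X p) = cls (fun t => nfs l t (nfs m t (repr X t))) /\
      ext (partial ord0 alpha) (vcons X p) =
        cls (fun t => nfs (dl l) t (nfs m t (repr X t)) * nfs (dl m) t (repr X t)).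
Proof.
  move=> HV HW Hl Hm HWs HVs.
  have [c [a [Ha [El Edl]]]] := nfs_ord _ _ Hl.
  have [e [b [Hb [Em Edm]]]] := nfs_ord _ _ Hm.
  move: c a Ha El Edl e b Hb Em Edm; set K := size l; set M := size m => c a Ha El Edl e b Hb Em Edm.
  pose p (k : 'I_(K + M)) := match split k with
    inl i => cls (fun t => tpow t (c i)) | inr j => cls (fun t => tpow t (e j)) end.
  have pl i : sim (repr (p (lshift M i))) (fun t => tpow t (c i)).
    rewrite /p (unsplitK (inl i)); apply: repr_cls; apply: Ro_tpow1; exact: (proj1 (Ha i)).
  have pr j : sim (repr (p (rshift K j))) (fun t => tpow t (e j)).
    rewrite /p (unsplitK (inr j)); apply: repr_cls; apply: Ro_tpow1; exact: (proj1 (Hb j)).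
  pose zl i : 'I_(K + M).+1 := lift ord0 (lshift M i).
  pose zr j : 'I_(K + M).+1 := lift ord0 (rshift K j).
  pose inner (z : vec (K + M).+1) := gsum (enum 'I_M) (fun j => z (zr j) * b j (z ord0)).
  pose dinner (z : vec (K + M).+1) := gsum (enum 'I_M) (fun j => z (zr j) * Derive (b j) (z ord0)).
  pose alpha (z : vec (K + M).+1) := gsum (enum 'I_K) (fun i => z (zl i) * a i (inner z)).
  pose dalpha (z : vec (K + M).+1) := gsum (enum 'I_K) (fun i => z (zl i) * Derive (a i) (inner z)) * dinner z.
  pose U0 (z : vec (K + M).+1) := W (z ord0).
  have HU0 : openv U0.
    by move=> z /HW [r [Hr H]]; exists r; split=> // z' Hz; exact: H.
  have Ci n : Ck n U0 inner.
    apply: Ck_gsum => // j; apply: Ck_mult => //; first exact: Ck_proj.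
    apply: (Ck_comp _ n _ W) => //; [exact: (proj2 (Hb j)) | exact: Ck_proj].
  (* The outer coefficients are smooth only on [V], so [alpha] is considered where the inner sum
     lands in [V]. *)
  pose U1 (z : vec (K + M).+1) := U0 z /\ V (inner z).
  have HU1 : openv U1.
    move=> z [Hz0 HzV]; have [r1 [Hr1 H1]] := HU0 _ Hz0; have [r2 [Hr2 H2]] := HV _ HzV.
    have [r3 [Hr3 H3]] := Ck_contin _ _ _ _ _ (Ci 0%N) Hz0 _ Hr2.
    exists (Rmin r1 r3); split; first exact: Rmin_pos.
    move=> z' Hz'; split; first by apply: H1 => i; apply: Rlt_le_trans (Hz' i) (Rmin_l _ _).
    by apply: H2; apply: H3 => i; apply: Rlt_le_trans (Hz' i) (Rmin_r _ _).
  have Ck_sub n (U U' : vec (K + M).+1 -> Prop) f : (forall z, U' z -> U z) -> Ck n U f -> Ck n U' f.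
    move=> HU'; elim: n f => [|n IH] f [h1 h2].
      by split=> // z /HU'; apply: h1.
    split=> [z /HU'|i]; first exact: h1.
    by have [h3 h4] := h2 i; split=> [z /HU'|]; [exact: h3 | exact: IH].
  have Ca n : Ck n U1 alpha.
    apply: Ck_gsum => // i; apply: Ck_mult => //; first exact: Ck_proj.
    apply: (Ck_comp _ n _ V) => //; first exact: (proj2 (Ha i)).
      by move=> z [].
    by apply: Ck_sub (Ci n) => z [].
  have up0 (z : vec (K + M).+1) h k : upd z ord0 h (lift ord0 k) = z (lift ord0 k) by [].
  have Dinner z : U0 z -> is_derive (fun h => inner (upd z ord0 h)) (z ord0) (dinner z).
    move=> Hz.
    apply: (is_derive_gsum _ (fun j h => upd z ord0 h (zr j) * b j (upd z ord0 h ord0))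
      (fun j h => z (zr j) * Derive (b j) h)) => j.
    apply: (is_derive_ext (fun h => z (zr j) * b j h)) => [h|]; first by rewrite up0 upd_same.
    by apply: is_derive_scal; apply: (sm_is_derive W) => //; apply: (proj2 (Hb j)).
  have Dalpha z : U1 z -> partial ord0 alpha z = dalpha z.
    move=> [Hz HzV]; apply: is_derive_unique.
    rewrite /dalpha -gsum_mulr.
    apply: (is_derive_gsum _ (fun i h => upd z ord0 h (zl i) * a i (inner (upd z ord0 h)))
      (fun i h => z (zl i) * Derive (a i) (inner z) * dinner z)) => i.
    apply: (is_derive_ext (fun h => z (zl i) * a i (inner (upd z ord0 h)))) => [h|]; first by rewrite up0.
    rewrite Rmult_assoc [Derive _ _ * _]Rmult_comm.
    apply: is_derive_scal; apply: (is_derive_comp (a i)); last exact: Dinner.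
    by rewrite upd_id; apply: (sm_is_derive V) => //; apply: (proj2 (Ha i)).
  (* The standard part of t^c is 1 for c = 0 and 0 otherwise, that is [tpow 0 c]. Hence the inner
     sum at [q0] is the inner normal form at t = 0. *)
  pose q0 := fun i => std (p i).
  have stdl i : q0 (lshift M i) = tpow 0 (c i) by exact: sim_0 (pl i).
  have stdr j : q0 (rshift K j) = tpow 0 (e j) by exact: sim_0 (pr j).
  have inner0 s : inner (vcons s q0) = nfs m 0 s.
    rewrite Em; apply: gsum_ext => j; rewrite /zr vconsS stdr.
    by congr (_ * b _ _); rewrite vcons0.
  have Uz0 : U1 (vcons s0 q0) by split; rewrite ?inner0 // /U0 vcons0.
  (* A local representation needs a product domain, which [U1] is not; a box around the standard
     point is one. *)
  have [d [Hd Hbox]] := HU1 _ Uz0.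
  have HU2 (z : vec (K + M).+1) : near s0 d (z ord0) -> (forall j, Rabs (z (lift ord0 j) - q0 j) < d) -> U1 z.
    move=> h1 h2; apply: Hbox; apply: vec_split; first by rewrite vcons0.
    by move=> j; rewrite vconsS.
  exists (near s0 d), (K + M)%N, (box _ q0 d), p, alpha.
  split; first exact: openR_near.
  split; first exact: near_refl.
  split.
    move=> q Hq.
    pose F := fun (k : 'I_(K + M)) r => forall y : vec (K + M), Rabs (y k - q k) < r -> Rabs (y k - q0 k) < d.
    (* One radius for all coordinates: a minimum over the finite list of indices. *)
    have [r [Hr H]] : exists r, 0 < r /\ forall k, In k (enum 'I_(K + M)) -> F k r.
      elim: (enum _) => [|k s [r [Hr H]]]; first by exists 1; split; [lra | move=> k []].
      have [r' [Hr' H']] := openR_near (q0 k) d _ (Hq k).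
      exists (Rmin r r'); split; first exact: Rmin_pos.
      move=> k' [<-|Hk'] y Hy.
        by apply: H'; apply: Rlt_le_trans Hy (Rmin_r _ _).
      by apply: H => //; apply: Rlt_le_trans Hy (Rmin_l _ _).
    exists r; split=> // y Hy k; apply: H (Hy k); exact: In_enum.
  split; first by move=> k; rewrite Rminus_diag Rabs_R0.
  split; first by move=> n; apply: Ck_sub (Ca n) => z [h1 h2]; apply: HU2.
  move=> X HX.
  have [HWX HVX] : U1 (vcons (std X) q0).
    by apply: HU2; rewrite ?vcons0 // => j; rewrite vconsS Rminus_diag Rabs_R0.
  rewrite /U0 vcons0 in HWX; rewrite inner0 in HVX.
  split=> //; split=> //.
  have HRm : Ro (fun t => nfs m t (repr X t)) by apply: (Ro_nfs W) => //; apply: Ro_repr.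
  have HRb j : Ro (fun t => b j (repr X t)).
    by apply: (Ro_comp W) => //; [apply: (proj2 (Hb j)) | apply: Ro_repr].
  pose zt t : vec (K + M).+1 := fun i => repr (vcons X p i) t.
  have zt0 t : zt t ord0 = repr X t by rewrite /zt vcons0.
  have ztl i t : zt t (zl i) = repr (p (lshift M i)) t by rewrite /zt /zl vconsS.
  have ztr j t : zt t (zr j) = repr (p (rshift K j)) t by rewrite /zt /zr vconsS.
  have Sinner : sim (fun t => nfs m t (repr X t)) (fun t => inner (zt t)).
    apply: sim_sym; apply: sim_trans (sim_eq (fun t => gsum (enum 'I_M) (fun j => tpow t (e j) * b j (repr X t))) _ _); last by move=> t; rewrite Em.
    apply: (sim_gsum _ (fun j t => zt t (zr j) * b j (zt t ord0)) (fun j t => tpow t (e j) * b j (repr X t))) => j.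
    apply: sim_mul => //.
    - by apply: Ro_sim (Ro_repr (p (rshift K j))) _; apply: sim_eq => t; rewrite ztr.
    - by apply: sim_trans (pr j); apply: sim_eq => t; rewrite ztr.
    - by apply: sim_eq => t; rewrite zt0.
  have HRi := Ro_sim _ _ HRm Sinner.
  have key (f : 'I_K -> R -> R) : (forall i, sm V (f i)) ->
    sim (fun t => gsum (enum 'I_K) (fun i => tpow t (c i) * f i (nfs m t (repr X t))))
        (fun t => gsum (enum 'I_K) (fun i => zt t (zl i) * f i (inner (zt t)))).
    move=> Hf; apply: (sim_gsum _ (fun i t => tpow t (c i) * f i (nfs m t (repr X t)))
      (fun i t => zt t (zl i) * f i (inner (zt t)))) => i.
    apply: sim_mul.
    - apply: Ro_tpow1; exact: (proj1 (Ha i)).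
    - apply: (Ro_comp V _ (fun t => inner (zt t))) => //.
      by rewrite -(sim_0 _ _ Sinner).
    - by apply: sim_sym; apply: sim_trans (pl i); apply: sim_eq => t; rewrite ztl.
    - by apply: (sim_comp V (f i) (fun t => nfs m t (repr X t))).
  have HRl : Ro (fun t => nfs l t (nfs m t (repr X t))) by apply: (Ro_nfs V _ (fun t => nfs m t (repr X t))).
  have HRdl : Ro (fun t => nfs (dl l) t (nfs m t (repr X t))).
    by apply: (Ro_nfs V _ (fun t => nfs m t (repr X t))) => //; apply: good_dl.
  have HRdm : Ro (fun t => nfs (dl m) t (repr X t)).
    by apply: (Ro_nfs W) => //; [apply: good_dl | apply: Ro_repr].
  have Sdinner : sim (fun t => nfs (dl m) t (repr X t)) (fun t => dinner (zt t)).
    apply: sim_sym; apply: sim_trans (sim_eq (fun t => gsum (enum 'I_M) (fun j => tpow t (e j) * Derive (b j) (repr X t))) _ _); last by move=> t; rewrite Edm.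
    apply: (sim_gsum _ (fun j t => zt t (zr j) * Derive (b j) (zt t ord0)) (fun j t => tpow t (e j) * Derive (b j) (repr X t))) => j.
    apply: sim_mul => //.
    - by apply: Ro_sim (Ro_repr (p (rshift K j))) _; apply: sim_eq => t; rewrite ztr.
    - by apply: (Ro_comp W) => //; [apply/sm_Derive/(proj2 (Hb j)) | apply: Ro_repr].
    - by apply: sim_trans (pr j); apply: sim_eq => t; rewrite ztr.
    - by apply: sim_eq => t; rewrite zt0.
  split; symmetry; apply: cls_eq => //.
  - apply: sim_trans (key a (fun i => proj2 (Ha i))).
    by apply: sim_eq => t; rewrite El.
  - exact: Ro_mul.
  - apply: (sim_trans _ (fun t => dalpha (zt t))).
      apply: sim_mul => //; first exact: Ro_sim Sdinner.
      apply: sim_trans (key (fun i => Derive (a i)) (fun i => sm_Derive _ _ (proj2 (Ha i)))).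
      by apply: sim_eq => t; rewrite Edl.
    (* The formula [Dalpha] holds on [U1] only, and [zt t] is known to lie there only for small
       t. *)
    apply: sim_ev.
    have HU1t : ev (fun t => forall k, In k (enum 'I_(K + M)) -> Rabs (repr (p k) t - q0 k) < d).
      by apply: ev_list => k _; apply: Ro_cont => //; apply: Ro_repr.
    apply: ev_mono (ev_and _ _ HU1t (ev_near _ _ _ HX)) => t _ [h1 h2].
    symmetry; apply: Dalpha; apply: HU2; first by rewrite /zt vcons0.
    move=> k; rewrite /zt vconsS; apply: h1; exact: In_enum.
Qed.

(** * Uniqueness of coefficients *)

Definition coef (l : list (R * (R -> R))) (c y : R) : R :=
  fold_right (fun p acc => (if Req_EM_T (fst p) c then snd p y else 0) + acc) 0 l.

Definition drop_exp (c : R) (l : list (R * (R -> R))) : list (R * (R -> R)) :=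
  List.filter (fun p => if Req_EM_T (fst p) c then false else true) l.

Lemma nfs_drop_exp c l t y : nfs l t y = tpow t c * coef l c y + nfs (drop_exp c l) t y.
Proof.
  elim: l => [|p l IH] /=; first ring.
  by rewrite IH; case: (Req_EM_T (fst p) c) => [E|_] /=; [rewrite E|]; ring.
Qed.

Lemma coef_drop_exp_same c l y : coef (drop_exp c l) c y = 0.
Proof.
  elim: l => //= p l IH; case: (Req_EM_T (fst p) c) => [_|N] //=.
  by case: (Req_EM_T (fst p) c) => //= _; rewrite IH; ring.
Qed.

Lemma coef_drop_exp c c' l y : c' <> c -> coef (drop_exp c l) c' y = coef l c' y.
Proof.
  move=> N; elim: l => //= p l IH.
  case: (Req_EM_T (fst p) c) => [E|N'] /=; last by rewrite IH.
  case: (Req_EM_T (fst p) c') => [E'|_] /=; last by rewrite IH; ring.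
  by case: N; rewrite -E'.
Qed.

Lemma drop_exp_In c l p : In p (drop_exp c l) -> In p l /\ fst p <> c.
Proof.
  by move=> /filter_In [H]; case: (Req_EM_T (fst p) c).
Qed.

Lemma size_drop_exp c l : (size (drop_exp c l) <= size l)%N.
Proof.
  elim: l => //= p l IH; case: (Req_EM_T (fst p) c) => _ //=.
  exact: leq_trans IH (leqnSn _).
Qed.

Lemma size_drop_exp_lt c l p : In p l -> fst p = c -> (size (drop_exp c l) < size l)%N.
Proof.
  elim: l => //= q l IH [->|Hp] Hc.
    by case: (Req_EM_T (fst p) c) => //= _; rewrite ltnS size_drop_exp.
  case: (Req_EM_T (fst q) c) => _ /=; last by rewrite ltnS IH.
  by apply: ltnW; rewrite ltnS; apply: IH.
Qed.

Lemma coef_notin l c y : (forall p, In p l -> fst p <> c) -> coef l c y = 0.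
Proof.
  elim: l => //= p l IH H; rewrite IH; last by move=> q Hq; apply: H; right.
  case: (Req_EM_T (fst p) c) => /= [E|_]; last ring.
  by case: (H p (or_introl erefl)).
Qed.

Lemma coef_app l m c y : coef (app l m) c y = coef l c y + coef m c y.
Proof. by elim: l => [|p l IH] /=; [ring | rewrite IH; ring]. Qed.

Lemma exists_min_exp (l : list (R * (R -> R))) : l <> nil ->
  exists p, In p l /\ forall q, In q l -> fst p <= fst q.
Proof.
  elim: l => // p l IH _.
  case: l IH => [|q l] IH; first by exists p; split; [left | move=> q [<-|[]]; lra].
  have [//|r [Hr H]] := IH.
  case: (Rle_dec (fst p) (fst r)) => Hpr.
    exists p; split; first by left.
    by move=> s [<-|/H]; lra.
  exists r; split; first by right.
  by move=> s [<-|/H]; lra.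
Qed.

(** Relative to t^c0 each term carries a factor t^(c - c0) that tends to 0, so a lowest power cannot
    be cancelled by higher ones. *)
Lemma nfs_higher l c0 y eps : 0 <= c0 -> (forall p, In p l -> c0 < fst p) -> 0 < eps ->
  ev (fun t => Rabs (nfs l t y) <= eps * tpow t c0).
Proof.
  move=> Hc0; elim: l eps => [|[c a] l IH] eps H He /=.
    apply: ev_all => t Ht; rewrite Rabs_R0; apply: Rmult_le_pos; first lra.
    exact: tpow_ge0.
  have Hc : c0 < c by apply: (H (c, a)); left.
  have HA : 0 < Rabs (a y) + 1 by have := Rabs_pos (a y); lra.
  have He' : 0 < eps / 2 / (Rabs (a y) + 1) by apply: Rdiv_lt_0_compat; lra.
  apply: ev_mono (ev_and _ _ (IH (eps / 2) (fun p Hp => H p (or_intror Hp)) ltac:(lra))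
    (tpow_small (c - c0) _ ltac:(lra) He')) => t Ht [h1 h2].
  have E : tpow t c = tpow t c0 * tpow t (c - c0).
    rewrite -tpow_plus //; try lra.
    by congr tpow; ring.
  have h3 := tpow_ge0 t c0 Ht; have h4 := tpow_ge0 t (c - c0) Ht; have h5 := Rabs_pos (a y).
  have h6 : tpow t (c - c0) * Rabs (a y) <= eps / 2.
    have -> : eps / 2 = eps / 2 / (Rabs (a y) + 1) * (Rabs (a y) + 1) by field; lra.
    by apply: Rmult_le_compat; lra.
  have h7 := Rabs_triang (tpow t c * a y) (nfs l t y).
  rewrite Rabs_mult (Rabs_pos_eq (tpow t c)) in h7; last exact: tpow_ge0.
  rewrite E in h7.
  have h8 : tpow t c0 * (tpow t (c - c0) * Rabs (a y)) <= tpow t c0 * (eps / 2).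
    exact: Rmult_le_compat_l.
  rewrite E; lra.
Qed.

Lemma coef_0_of_little_o l y : (forall p, In p l -> 0 <= fst p) ->
  little_o (fun t => nfs l t y) -> forall c, c <= 1 -> coef l c y = 0.
Proof.
  have [n] := ubnP (size l); elim: n l => // n IH l Hn Hl Ho c Hc.
  case: (classic (l = nil)) => [->|/exists_min_exp [p [Hp Hmin]]] //.
  have Hp0 := Hl p Hp; set c0 := fst p in Hmin Hp0.
  case: (Rle_dec c0 1) => Hc0; last first.
    by apply: coef_notin => q /Hmin; lra.
  have Hd q : In q (drop_exp c0 l) -> c0 < fst q.
    by move=> /drop_exp_In [/Hmin h1 h2]; lra.
  have Hs : coef l c0 y = 0.
    apply: NNPP => N; set s := coef l c0 y in N.
    (* One quarter bounds the whole sum, using t <= t^c0, and one quarter the higher terms. Together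
       they give |s| t^c0 <= |s| t^c0 / 2, a contradiction. *)
    have He : 0 < Rabs s / 4 by have := Rabs_pos_lt _ N; lra.
    have /little_oE Ho' := Ho.
    have [d [Hd0 H]] := ev_and _ _ (Ho' _ He) (ev_and _ _ (nfs_higher _ c0 y _ Hp0 Hd He) (ev_lt 1 Rlt_0_1)).
    have [|h1 [h2 h3]] := H (d / 2); first lra.
    move: h1 h2 h3; set t := d / 2 => h1 h2 h3; have Ht : 0 < t by rewrite /t; lra.
    have h4 : t <= tpow t c0 by rewrite -{1}(tpow_1r t); [apply: tpow_decr; lra | lra].
    rewrite (nfs_drop_exp c0) -/s in h1.
    have h5 := Rabs_triang (tpow t c0 * s + nfs (drop_exp c0 l) t y) (- nfs (drop_exp c0 l) t y).
    have E : tpow t c0 * s + nfs (drop_exp c0 l) t y + - nfs (drop_exp c0 l) t y = tpow t c0 * s by ring.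
    rewrite E Rabs_Ropp Rabs_mult (Rabs_pos_eq (tpow t c0)) in h5; last lra.
    have h6 : Rabs s / 4 * t <= Rabs s / 4 * tpow t c0 by apply: Rmult_le_compat_l; lra.
    have h7 : 0 < tpow t c0 * Rabs s by apply: Rmult_lt_0_compat; [lra | apply: Rabs_pos_lt].
    lra.
  case: (Req_EM_T c c0) => [->|Nc] //.
  rewrite -(coef_drop_exp c0) //; apply: IH => //.
  - by apply: leq_trans (size_drop_exp_lt c0 l p Hp erefl) _; rewrite -ltnS.
  - by move=> q /drop_exp_In [/Hl].
  - by apply: little_o_ext Ho; apply: ev_all => t _; rewrite (nfs_drop_exp c0) Hs; ring.
Qed.

Lemma sm_coef V l c : openR V -> good V l -> sm V (coef l c).
Proof.
  move=> HV; elim: l => [|p l IH] Hl /=; first exact: sm_const.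
  apply: sm_plus => //; last by apply: IH; apply: good_tl Hl.
  case: (Req_EM_T (fst p) c) => _ /=; last exact: sm_const.
  by have [] := Hl p (or_introl erefl).
Qed.

Lemma coef_dl V l c y : openR V -> good V l -> V y -> coef (dl l) c y = Derive (coef l c) y.
Proof.
  move=> HV Hl Hy; symmetry; apply: is_derive_unique.
  elim: l Hl => [|p l IH] Hl /=; first exact: is_derive_const.
  apply: (is_derive_plus (fun y => if Req_EM_T (fst p) c then snd p y else 0) (coef l c)); last first.
    by apply: IH; apply: good_tl Hl.
  case: (Req_EM_T (fst p) c) => _ /=; last exact: is_derive_const.
  by apply: (sm_is_derive V) => //; have [] := Hl p (or_introl erefl).
Qed.

(** The Taylor polynomial of [s] at [x 0] is zero, and the remainder is a power of the increment
    that is o(t). So [s] need not vanish at the points [x t], which matters at the end of an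
    interval. *)
Lemma flat_little_o V s x : openR V -> sm V s -> Ro x -> V (x 0) ->
  (forall n, Derive_n s n (x 0) = 0) -> little_o (fun t => s (x t)).
Proof.
  move=> HV Hs Hx H0 Hflat.
  have [n [Hn0 Hn]] := Ro_nilpotent _ Hx.
  have [e1 [He1 H1]] := HV _ H0.
  (* The n-th derivative is 0 at [x 0], hence at most 1 in absolute value nearby. *)
  have [e2 [He2 H2]] := ex_derive_eps_delta _ _ 1 (Hs n _ H0) Rlt_0_1.
  have He : 0 < Rmin e1 e2 by apply: Rmin_pos.
  apply: (little_o_le _ _ 1 Hn).
  apply: ev_mono (Ro_cont _ _ Hx He) => t _ Ht.
  rewrite (Rabs_pos_eq (_ ^ _)); last by apply: pow_le; apply: Rabs_pos.
  have := taylor_bound n (Derive_n s) (x 0) (Rabs (x t - x 0)) 1 _ _ (x t) (Rle_refl _).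
  have -> : tayl (Derive_n s) (x 0) n (x t - x 0) = 0.
    by elim: (n) => //= k ->; rewrite Hflat /Rdiv; ring.
  rewrite Rminus_0_r /=; apply.
    move=> k w Hw; apply: (sm_is_derive_n V) => //; apply: H1.
    by have := Rmin_l e1 e2; lra.
  move=> w Hw; have := H2 w; rewrite Hflat Rminus_0_r.
  by have := Rmin_r e1 e2; move=> h1 /(_ ltac:(lra)); lra.
Qed.

(** Groups of exponent at most 1 are o(t) by flatness, the others because t^c already is. The
    induction removes one group at a time, since only grouped coefficients are known to be flat. *)
Lemma nfs_flat V l x : openR V -> good V l -> Ro x -> V (x 0) ->
  (forall c n, c <= 1 -> Derive_n (coef l c) n (x 0) = 0) -> little_o (fun t => nfs l t (x t)).
Proof.
  move=> HV + Hx H0.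
  have [n] := ubnP (size l); elim: n l => // n IH [|[c a] l'] Hn Hl Hflat; first exact: little_o_0.
  set l := (c, a) :: l' in Hn Hl Hflat *.
  have [Hc _] := Hl (c, a) (or_introl erefl); simpl in Hc.
  have Hcf : sm V (coef l c) by apply: sm_coef.
  apply: (little_o_ext (fun t => tpow t c * coef l c (x t) + nfs (drop_exp c l) t (x t))).
    by apply: ev_all => t _; rewrite -nfs_drop_exp.
  apply: little_o_add; last first.
    apply: IH.
    - by apply: leq_trans (size_drop_exp_lt c l (c, a) (or_introl erefl) erefl) _; rewrite -ltnS.
    - by move=> q /drop_exp_In [/Hl].
    - move=> c' k Hc'; case: (Req_EM_T c' c) => [->|N].
        rewrite (Derive_n_ext _ (fun _ => 0)); last by move=> y; apply: coef_drop_exp_same.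
        by case: k => // k; rewrite Derive_n_const.
      rewrite (Derive_n_ext _ (coef l c')); first exact: Hflat.
      by move=> y; apply: coef_drop_exp.
  case: (Rle_dec c 1) => Hc1.
    apply: (little_o_scal _ _ 1); last by apply: (flat_little_o V) => // k; apply: Hflat.
    apply: ev_mono (ev_lt 1 Rlt_0_1) => t Ht H1; rewrite Rabs_pos_eq; last exact: tpow_ge0.
    by apply: tpow_le1; lra.
  have HR : Ro (fun t => coef l c (x t)) by apply: (Ro_comp V).
  have := little_o_scal _ _ _ (Ro_bounded _ HR) (tpow_o c ltac:(lra)).
  by apply: little_o_ext; apply: ev_all => t _; ring.
Qed.

Lemma exists_near_in lo hi r e : lo < hi -> lo <= r <= hi -> 0 < e ->
  exists y, lo < y < hi /\ Rabs (y - r) < e.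
Proof.
  move=> Hlt Hr He.
  (* The point [y] lies the fraction [k] of the way from [r] to the midpoint: strictly inside since
     0 < k < 1, and within k (hi - lo) <= e/2 of [r]. *)
  set k := Rmin (1 / 2) (e / (2 * (hi - lo))).
  have Hk : 0 < k by apply: Rmin_pos; [lra | apply: Rdiv_lt_0_compat; lra].
  have h1 : k <= 1 / 2 := Rmin_l _ _; have h2 : k <= e / (2 * (hi - lo)) := Rmin_r _ _.
  have h3 : k * (hi - lo) <= e / 2.
    have -> : e / 2 = e / (2 * (hi - lo)) * (hi - lo) by field; lra.
    by apply: Rmult_le_compat_r; lra.
  exists (r + k * ((lo + hi) / 2 - r)); split; first by split; nra.
  have -> : r + k * ((lo + hi) / 2 - r) - r = k * ((lo + hi) / 2 - r) by ring.
  apply: Rle_lt_trans (_ : k * (hi - lo) < e); last lra.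
  rewrite Rabs_mult (Rabs_pos_eq k); last lra.
  apply: Rmult_le_compat_l; first lra.
  apply: Rabs_le; lra.
Qed.

(** Inside the interval [s] is locally zero, so all derivatives vanish. At an end they vanish by
    continuity, as interior points come arbitrarily close. *)
Lemma flat_at V s lo hi r : openR V -> sm V s -> lo < hi -> lo <= r <= hi -> V r ->
  (forall y, lo < y < hi -> V y -> s y = 0) -> forall n, Derive_n s n r = 0.
Proof.
  move=> HV Hs Hlt Hr HVr H0 n.
  have Hin y : lo < y < hi -> V y -> Derive_n s n y = 0.
    move=> Hy HVy.
    have Hloc : locally y (fun z => s z = 0).
      have Ho : openR (fun z => lo < z < hi /\ V z).
        move=> z [h1 /HV [d [Hd H]]]; exists (Rmin d (Rmin (z - lo) (hi - z))); split.
          by apply: Rmin_pos => //; apply: Rmin_pos; lra.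
        move=> w Hw; have m1 := Rmin_l d (Rmin (z - lo) (hi - z)).
        have m2 := Rmin_r d (Rmin (z - lo) (hi - z)).
        have m3 := Rmin_l (z - lo) (hi - z); have m4 := Rmin_r (z - lo) (hi - z).
        split; last by apply: H; lra.
        have /Rabs_def2 : Rabs (w - z) < Rmin (z - lo) (hi - z) by lra.
        lra.
      by apply: filter_imp (openR_locally _ y Ho (conj Hy HVy)) => z []; apply: H0.
    rewrite (Derive_n_ext_loc s (fun _ => 0)) //.
    by case: (n) => // k; rewrite Derive_n_const.
  apply: NNPP => N.
  have [d1 [Hd1 H1]] := HV _ HVr.
  have [d2 [Hd2 H2]] := ex_derive_eps_delta _ _ _ (Hs n r HVr) (Rabs_pos_lt _ N).
  have Hd : 0 < Rmin d1 d2 by apply: Rmin_pos.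
  have [y [Hy Hyr]] := exists_near_in lo hi r _ Hlt Hr Hd.
  have := H2 y (Rlt_le_trans _ _ _ Hyr (Rmin_r _ _)).
  rewrite Hin //; last by apply: H1; apply: Rlt_le_trans Hyr (Rmin_l _ _).
  by rewrite Rminus_0_l Rabs_Ropp; lra.
Qed.

(** * Intervals *)

Lemma FRle_std X Y : FRle X Y -> std X <= std Y.
Proof.
  move=> [x [y [z [/is_repP [_ /sim_0 Hx] [/is_repP [_ /sim_0 Hy] [_ [/sim_0 Hz H]]]]]]].
  have := ev_0 _ H; rewrite /std Hx Hy Hz; lra.
Qed.

Lemma std_lt_FRle X Y : std X < std Y -> FRle X Y /\ X <> Y.
Proof.
  move=> H; split; last by move=> E; rewrite E in H; lra.
  exists (repr X), (repr Y), (fun _ => 0).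
  split; first exact: is_rep_repr.
  split; first exact: is_rep_repr.
  split; first exact: Ro_const.
  split; first exact: sim_refl.
  set e := (std Y - std X) / 2; have He : 0 < e by rewrite /e; lra.
  have [d [Hd Hev]] := ev_and _ _ (Ro_cont _ e (Ro_repr X) He) (Ro_cont _ e (Ro_repr Y) He).
  exists d; split=> // t /Hev [/Rabs_def2 h1 /Rabs_def2 h2].
  rewrite -/(std X) in h1; rewrite -/(std Y) in h2; rewrite /e in h1 h2; lra.
Qed.

(* Only this trace of the order of an interval matters: near each of its points, [J]
   contains every Fermat real whose standard part lies in some real interval [(lo, hi)],
   and no standard part of a nearby point of [J] leaves [[lo, hi]]. *)
Definition wide (J : FR -> Prop) : Prop :=
  (forall X d, J X -> 0 < d -> exists lo hi, lo < hi /\ lo <= std X <= hi /\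
     (forall r, lo < r < hi -> near (std X) d r) /\
     (forall Y, lo < std Y < hi -> J Y) /\
     (forall Y, J Y -> near (std X) d (std Y) -> lo <= std Y <= hi)) /\
  (forall X Y Z, J X -> J Y -> std X < std Z < std Y -> J Z).

(** Cutting [A] off at s - d replaces an infinite or distant end by a real one. The last clause is
    for the proof that lo < hi. *)
Lemma lower_end (A : Rbar) (s d : R) : 0 < d -> Rbar_le A s ->
  exists lo, s - d <= lo <= s /\ (forall r, lo < r -> Rbar_lt A (Rbar.Finite r)) /\
    (forall r : R, Rbar_le A r -> near s d r -> lo <= r) /\ (Rbar_lt A s -> lo < s).
Proof.
  case: A => [A| |] Hd //= HA.
  - exists (Rmax A (s - d)); have m1 := Rmax_l A (s - d); have m2 := Rmax_r A (s - d).
    split; first by split=> //; apply: Rmax_lub; lra.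
    split; first by move=> r ? /=; lra.
    split; first by move=> r h1 /Rabs_def2 h2; apply: Rmax_lub; lra.
    by move=> h; apply: Rmax_lub_lt; lra.
  - exists (s - d); split; first lra.
    split=> //; split; last by move=> _; lra.
    by move=> r _ /Rabs_def2; lra.
Qed.

Lemma upper_end (B : Rbar) (s d : R) : 0 < d -> Rbar_le s B ->
  exists hi, s <= hi <= s + d /\ (forall r, r < hi -> Rbar_lt (Rbar.Finite r) B) /\
    (forall r : R, Rbar_le r B -> near s d r -> r <= hi) /\ (Rbar_lt s B -> s < hi).
Proof.
  case: B => [B| |] Hd //= HB.
  - exists (Rmin B (s + d)); have m1 := Rmin_l B (s + d); have m2 := Rmin_r B (s + d).
    split; first by split=> //; apply: Rmin_glb; lra.
    split; first by move=> r ? /=; lra.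
    split; first by move=> r h1 /Rabs_def2 h2; apply: Rmin_glb; lra.
    by move=> h; apply: Rmin_glb_lt; lra.
  - exists (s + d); split; first lra.
    split=> //; split; last by move=> _; lra.
    by move=> r _ /Rabs_def2; lra.
Qed.

Lemma noninf_wide J : noninf_interval J -> wide J.
Proof.
  move=> [k [a [b [_ [Hab HJ]]]]].
  set A := std_bar a in Hab; set B := std_bar b in Hab.
  have Ha X : FRbar_le a (FFin X) -> Rbar_le A (std X) by rewrite /A; case: (a) => [a'| |] //=; apply: FRle_std.
  have Hb X : FRbar_le (FFin X) b -> Rbar_le (std X) B by rewrite /B; case: (b) => [b'| |] //=; apply: FRle_std.
  have Ha' X : Rbar_lt A (std X) -> FRbar_lt a (FFin X).
    rewrite /A /FRbar_lt; case: (a) => [a'| |] //= /std_lt_FRle [h1 h2]; split=> //.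
    by move=> [].
  have Hb' X : Rbar_lt (std X) B -> FRbar_lt (FFin X) b.
    rewrite /B /FRbar_lt; case: (b) => [b'| |] //= /std_lt_FRle [h1 h2]; split=> //.
    by move=> [].
  have H1 X : J X -> Rbar_le A (std X) /\ Rbar_le (std X) B.
    by move=> /HJ; case: (k) => /= -[h1 h2]; (split; [apply: Ha | apply: Hb]);
      try exact: h1; try exact: h2; try exact: (proj1 h1); exact: (proj1 h2).
  have H2 X : Rbar_lt A (std X) -> Rbar_lt (std X) B -> J X.
    move=> /Ha' h1 /Hb' h2; apply/HJ; case: (k) => /=; split=> //;
      try exact: (proj1 h1); exact: (proj1 h2).
  split.
  - move=> X d /H1 [hA hB] Hd.
    have [lo [l1 [l2 [l3 l4]]]] := lower_end A (std X) d Hd hA.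
    have [hi [u1 [u2 [u3 u4]]]] := upper_end B (std X) d Hd hB.
    exists lo, hi; split.
      (* The standard part cannot sit at both ends, since A < B; so lo < [std X] or [std X] < hi. *)
      case: (Rle_lt_or_eq_dec lo (std X)) => [|h|h]; [lra | lra |].
      suff : std X < hi by lra.
      apply: u4; apply: NNPP => /Rbar_not_lt_le hBX.
      have E : Rbar_lt A (std X) by apply: Rbar_lt_le_trans Hab hBX.
      by have := l4 E; lra.
    split; first lra.
    split; first by move=> r Hr; apply: Rabs_def1; lra.
    split; first by move=> Y Hy; apply: H2; [apply: l2 | apply: u2]; lra.
    by move=> Y /H1 [h1 h2] hn; split; [apply: l3 | apply: u3].
  - move=> X Y Z /H1 [h1 _] /H1 [_ h2] [h3 h4]; apply: H2.
      exact: (Rbar_le_lt_trans A (std X) (std Z) h1 h3).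
    exact: (Rbar_lt_le_trans (std Z) (std Y) B h4 h2).
Qed.

(* The indicator of [P], extended constantly outside [[x, y]], has zero derivative. *)
Lemma connected (S P : R -> Prop) :
  (forall x y z, S x -> S y -> x < z < y -> S z) ->
  (forall r, S r -> exists d, 0 < d /\
     forall x y, S x -> S y -> near r d x -> near r d y -> P x -> P y) ->
  forall x y, S x -> S y -> P x -> P y.
Proof.
  move=> HS HP x y Sx Sy Px.
  set a := Rmin x y; set b := Rmax x y.
  have Hab : a <= b by rewrite /a /b /Rmin /Rmax; case: Rle_dec; lra.
  have Sab r : a <= r <= b -> S r.
    rewrite /a /b /Rmin /Rmax; case: Rle_dec => H /= Hr.
      case: (Req_EM_T r x) => [->|N1] //; case: (Req_EM_T r y) => [->|N2] //.
      by apply: (HS x y) => //; lra.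
    case: (Req_EM_T r x) => [->|N1] //; case: (Req_EM_T r y) => [->|N2] //.
    by apply: (HS y x) => //; lra.
  pose cl r := Rmax a (Rmin b r).
  have clab r : a <= cl r <= b.
    rewrite /cl; split; first exact: Rmax_l.
    by apply: Rmax_lub => //; apply: Rmin_l.
  have clid r : a <= r <= b -> cl r = r.
    by move=> Hr; rewrite /cl Rmin_right ?Rmax_right; lra.
  have cllip r s : Rabs (cl r - cl s) <= Rabs (r - s).
    rewrite /cl /Rmax /Rmin; case: (Rle_dec b r) => h1; case: (Rle_dec b s) => h2 /=;
      repeat (case: Rle_dec => ? /=); rewrite /Rabs; repeat (case: Rcase_abs => ?); lra.
  pose h r := if excluded_middle_informative (P (cl r)) then 1 else 0.
  have Hloc r : locally r (fun s => h s = h r).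
    have [d [Hd H]] := HP _ (Sab _ (clab r)).
    exists (mkposreal d Hd) => s Hs.
    have Hn : near (cl r) d (cl s) by apply: Rle_lt_trans (cllip s r) Hs.
    have Hr : near (cl r) d (cl r) by apply: near_refl.
    rewrite /h; case: (excluded_middle_informative (P (cl s))) => h1;
      case: (excluded_middle_informative (P (cl r))) => h2 //=.
      by case: h2; apply: H h1 => //; apply: Sab.
    by case: h1; apply: H h2 => //; apply: Sab.
  have Hh r : is_derive h r 0.
    apply: (is_derive_ext_loc (fun _ => h r)); last exact: is_derive_const.
    by apply: filter_imp (Hloc r) => s ->.
  have Ehab : h a = h b.
    case: (Req_EM_T a b) => [->|N] //.
    by apply: eq_is_derive => [t _|]; [apply: Hh | lra].
  have Exy : h x = h y.
    move: Ehab; rewrite /a /b /Rmin /Rmax; case: Rle_dec => _ /= E; lra.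
  have xab : a <= x <= b by split; [apply: Rmin_l | apply: Rmax_l].
  have yab : a <= y <= b by split; [apply: Rmin_r | apply: Rmax_r].
  move: Exy; rewrite /h !clid //.
  case: (excluded_middle_informative (P x)) => //= _.
  by case: (excluded_middle_informative (P y)) => //= _; lra.
Qed.

(** * Local normal forms and derivatives *)

Definition rep (J : FR -> Prop) (f : FR -> FR) (r0 d : R) (l : list (R * (R -> R))) : Prop :=
  0 < d /\ good (near r0 d) l /\ forall X, J X -> near r0 d (std X) -> f X = nf l X.

Lemma rep_sub J f r0 d l r1 d1 : rep J f r0 d l -> 0 < d1 ->
  (forall y, near r1 d1 y -> near r0 d y) -> rep J f r1 d1 l.
Proof.
  move=> [Hd [Hl Hf]] Hd1 H; split=> //; split; first exact: good_mono Hl.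
  by move=> X HX HnX; apply: Hf => //; apply: H.
Qed.

Lemma near_sub r0 d r1 : near r0 d r1 ->
  exists d1, 0 < d1 /\ forall y, near r1 d1 y -> near r0 d y.
Proof. by move=> H; have [d1 [Hd1 H1]] := openR_near r0 d r1 H; exists d1. Qed.

Lemma local_rep_rep S f X V pd P p alpha : local_rep S f X V pd P p alpha ->
  exists d l, rep S f (std X) d l /\
    forall Y, S Y -> near (std X) d (std Y) -> ext (partial ord0 alpha) (vcons Y p) = nf (dl l) Y.
Proof.
  move=> [HV [HX [HP [HPp [Ha Hf]]]]].
  have [d [l [Hd [HdV [Hl HE]]]]] := ext_nf V pd P p alpha (std X) HV HX HP HPp Ha.
  exists d, l; split; last by move=> Y _ /HE [].
  split=> //; split=> // Y HY HnY; rewrite Hf //; last exact: HdV.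
  by have [] := HE Y HnY.
Qed.

(** This is [comp_rep] with the identity as inner normal form, written as the single term t^0 y. *)
Lemma rep_local_rep S f r0 d l X : rep S f r0 d l -> near r0 d (std X) ->
  exists V pd P p alpha, local_rep S f X V pd P p alpha /\
    ext (partial ord0 alpha) (vcons X p) = nf (dl l) X.
Proof.
  move=> [Hd [Hl Hf]] HX; pose m := [:: (0, fun y : R => y)].
  have Em t y : nfs m t y = y by rewrite /= tpow_0r; ring.
  have Edm t y : nfs (dl m) t y = 1 by rewrite /= tpow_0r Derive_id; ring.
  have Hm : good (fun _ => True) m.
    move=> p [<-|[]] /=; split; first lra.
    by apply: sm_id => x _; exists 1; split=> //; lra.
  have HT : openR (fun _ => True) by move=> x _; exists 1; split=> //; lra.
  have HVX : near r0 d (nfs m 0 (std X)) by rewrite Em.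
  have [V' [pd [P [p [alpha [HV' [HX' [HP [HPp [Ha HE]]]]]]]]]] :=
    comp_rep _ _ l m (std X) (openR_near r0 d) HT Hl Hm I HVX.
  exists V', pd, P, p, alpha; split.
    split=> //; split=> //; split=> //; split=> //; split=> // Y HY HVY.
    have [_ [HnY [-> _]]] := HE Y HVY; rewrite Em in HnY.
    rewrite Hf // /nf; congr cls; apply: functional_extensionality => t; by rewrite Em.
  have [_ [_ [_ ->]]] := HE X HX'.
  rewrite /nf; congr cls; apply: functional_extensionality => t; by rewrite Em Edm Rmult_1_r.
Qed.

Definition neg (l : list (R * (R -> R))) : list (R * (R -> R)) :=
  List.map (fun p => (fst p, fun y => -1 * snd p y)) l.

Lemma good_neg V l : good V l -> good V (neg l).
Proof. by move=> Hl q /in_map_iff [p [<- /Hl [h1 h2]]] /=; split=> //; apply: sm_scal. Qed.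

Lemma nfs_neg l t y : nfs (neg l) t y = - nfs l t y.
Proof. by elim: l => [|p l IH] /=; [ring | rewrite IH; ring]. Qed.

Lemma nfs_dl_neg l t y : nfs (dl (neg l)) t y = - nfs (dl l) t y.
Proof. by elim: l => [|p l IH] /=; [ring | rewrite IH Derive_scal; ring]. Qed.

Lemma nf_eqP V l1 l2 X : openR V -> good V l1 -> good V l2 -> V (std X) ->
  nf l1 X = nf l2 X <-> little_o (fun t => nfs l1 t (repr X t) - nfs l2 t (repr X t)).
Proof.
  move=> HV H1 H2 HX.
  have R1 : Ro (fun t => nfs l1 t (repr X t)) by apply: (Ro_nfs V) => //; apply: Ro_repr.
  have R2 : Ro (fun t => nfs l2 t (repr X t)) by apply: (Ro_nfs V) => //; apply: Ro_repr.
  by split=> [|H]; [apply: cls_inj | apply: cls_eq].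
Qed.

Definition cst (r : R) : FR := cls (fun _ => r).

Lemma std_cst r : std (cst r) = r.
Proof. exact: (std_cls _ (Ro_const r)). Qed.

Lemma nfs_cst V l r : openR V -> good V l -> V r ->
  sim (fun t => nfs l t (repr (cst r) t)) (fun t => nfs l t r).
Proof.
  move=> HV Hl Hr; apply: sim_sym; apply: (sim_nfs V l (fun _ => r)) => //; first exact: Ro_const.
  by apply: sim_sym; apply: repr_cls; apply: Ro_const.
Qed.

(* Agreement at the real points of a one-sided neighbourhood forces all grouped
   coefficients of exponent at most 1 to agree there. *)
Lemma coef_diff_0 V l1 l2 r c : openR V -> good V l1 -> good V l2 -> V r ->
  nf l1 (cst r) = nf l2 (cst r) -> c <= 1 -> coef (app l1 (neg l2)) c r = 0.
Proof.
  move=> HV H1 H2 Hr /(nf_eqP V); rewrite std_cst => /(_ HV H1 H2 Hr) Ho.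
  have HD : good V (app l1 (neg l2)) by apply: good_app => //; apply: good_neg.
  apply: coef_0_of_little_o; first by move=> p /HD [].
  have := sim_sym _ _ (nfs_cst V _ r HV HD Hr).
  move=> /little_o_add /(_ Ho); apply: little_o_ext; apply: ev_all => t _.
  rewrite !nfs_app !nfs_neg; ring.
Qed.

Lemma Derive_coef_eq V l c n r : openR V -> good V l -> V r ->
  Derive_n (coef (dl l) c) n r = Derive_n (coef l c) (S n) r.
Proof.
  move=> HV Hl Hr; rewrite -Derive_n_Derive; apply: Derive_n_ext_loc.
  by apply: filter_imp (openR_locally _ _ HV Hr) => y; apply: coef_dl.
Qed.

(** The grouped coefficients of the difference vanish at the real points of (lo, hi), hence are flat
    at [std X] even if this is an end. Flatness passes to their derivatives, and [nfs_flat]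
    concludes at the possibly non-real point X. *)
Lemma rep_deriv_unique J f r0 d l1 l2 X : wide J -> rep J f r0 d l1 -> rep J f r0 d l2 ->
  J X -> near r0 d (std X) -> nf (dl l1) X = nf (dl l2) X.
Proof.
  move=> [HJ _] [Hd [H1 E1]] [_ [H2 E2]] HX HnX.
  set V := near r0 d in H1 H2 E1 E2 HnX; have HV : openR V := openR_near r0 d.
  have HD : good V (app l1 (neg l2)) by apply: good_app => //; apply: good_neg.
  have [e [He HeV]] := HV _ HnX.
  have [lo [hi [Hlt [Hr [Hin [HJin _]]]]]] := HJ X e HX He.
  apply/(nf_eqP V) => //; try exact: good_dl.
  apply: little_o_ext (_ : little_o (fun t => nfs (dl (app l1 (neg l2))) t (repr X t))).
    by apply: ev_all => t _; rewrite dl_app nfs_app nfs_dl_neg.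
  apply: (nfs_flat V) => //; [exact: good_dl | exact: Ro_repr | move=> c n Hc].
  rewrite (Derive_coef_eq V) //.
  apply: (flat_at V _ lo hi) => //; first exact: sm_coef.
  move=> y Hy HVy; apply: (coef_diff_0 V) => //.
  by rewrite -E1 ?E2 ?std_cst //; apply: HJin; rewrite std_cst.
Qed.

Lemma rep_smooth S f : (forall X, S X -> exists d l, rep S f (std X) d l) -> smooth S f.
Proof.
  move=> H X /H [d [l Hl]].
  have [V [pd [P [p [alpha [Hr _]]]]]] := rep_local_rep _ _ _ _ _ X Hl (near_refl _ _ (proj1 Hl)).
  by exists V, pd, P, p, alpha.
Qed.

(** The representation chosen inside [deriv] is arbitrary. It has a normal form of its own, which is
    compared with [l] on the smaller of the two neighbourhoods. *)
Lemma deriv_rep J f r0 d l X : wide J -> rep J f r0 d l -> J X -> near r0 d (std X) ->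
  deriv J f X = nf (dl l) X.
Proof.
  move=> HJ Hl HX HnX; rewrite /deriv.
  have [V [pd [P [p [alpha [Hr HE]]]]]] := rep_local_rep _ _ _ _ _ X Hl HnX.
  case: excluded_middle_informative => [H|[]]; last first.
    by exists (nf (dl l) X), V, pd, P, p, alpha.
  case: constructive_indefinite_description => D /= [V' [pd' [P' [p' [alpha' [Hr' ->]]]]]].
  have [d' [l' [Hl' HE']]] := local_rep_rep _ _ _ _ _ _ _ _ Hr'.
  have Hd' := proj1 Hl'.
  rewrite HE' //; last exact: near_refl.
  have [d1 [Hd1 H1]] := near_sub _ _ _ HnX.
  have Hm : 0 < Rmin d' d1 by apply: Rmin_pos.
  apply: (rep_deriv_unique J f (std X) (Rmin d' d1)) => //; last exact: near_refl.
  - by apply: rep_sub Hl' Hm _ => y; apply: near_mono; apply: Rmin_l.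
  - by apply: rep_sub Hl Hm _ => y Hy; apply: H1; apply: near_mono Hy; apply: Rmin_r.
Qed.

(* Both functions have the same derivative, so the grouped coefficients of their
   difference are constant on the real interval and only its value at [r0] remains. *)
Lemma rep_diff_locally_const J I1 I2 d l1 l2 X : wide J -> J X ->
  rep J I1 (std X) d l1 -> rep J I2 (std X) d l2 ->
  (forall Y, J Y -> near (std X) d (std Y) -> nf (dl l1) Y = nf (dl l2) Y) ->
  forall Y Y', J Y -> J Y' -> near (std X) d (std Y) -> near (std X) d (std Y') ->
    I1 Y = I2 Y -> I1 Y' = I2 Y'.
Proof.
  move=> [HJ _] HX [Hd [H1 E1]] [_ [H2 E2]] HE.
  set r0 := std X in H1 H2 E1 E2 HE *.
  set V := near r0 d in H1 H2 E1 E2 HE *; have HV : openR V := openR_near r0 d.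
  pose D := app l1 (neg l2).
  have HD : good V D by apply: good_app => //; apply: good_neg.
  have [lo [hi [Hlt [Hr [Hin [HJin HJout]]]]]] := HJ X d HX Hd.
  rewrite -/r0 in Hr.
  have Hs c : sm V (coef D c) by apply: sm_coef.
  have HDer c r n : c <= 1 -> lo <= r <= hi -> V r -> Derive_n (coef D c) (S n) r = 0.
    move=> Hc Hlr Vr; rewrite -Derive_n_Derive.
    apply: (flat_at V _ lo hi) => //; first exact: sm_Derive.
    move=> y Hy HVy; rewrite -(coef_dl V) //.
    have := coef_diff_0 V (dl l1) (dl l2) y c HV (good_dl _ _ H1) (good_dl _ _ H2) HVy _ Hc.
    rewrite dl_app !coef_app.
    have -> : coef (neg (dl l2)) c y = coef (dl (neg l2)) c y.
      elim: (l2) => //= p s ->; congr ((if _ then _ else _) + _).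
      by rewrite Derive_scal.
    apply; apply: HE; last by rewrite std_cst.
    by apply: HJin; rewrite std_cst.
  have Hr0 : V r0 by apply: near_refl.
  have Hconst c r : c <= 1 -> lo <= r <= hi -> V r -> coef D c r = coef D c r0.
    move=> Hc Hlr Vr.
    have Hseg t : Rmin r0 r <= t <= Rmax r0 r -> lo <= t <= hi /\ V t.
      rewrite /Rmin /Rmax; case: Rle_dec => /= h [h1 h2]; (split; first lra);
        apply: near_between Vr _; first by rewrite !Rabs_pos_eq; lra.
      by rewrite !Rabs_left1; lra.
    have [t Ht|t Ht|s [Hseg' E]] := MVT_gen (coef D c) r0 r (Derive (coef D c)).
    - by apply: (sm_is_derive V) => //; have [] := Hseg t ltac:(lra).
    - have [_ Vt] := Hseg t Ht.
      apply/continuity_pt_filterlim; apply: ex_derive_continuous; exact: (Hs c 0%N).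
    - have [hs Vs] := Hseg s Hseg'.
      have E0 : Derive (coef D c) s = 0 := HDer c s 0%N Hc hs Vs.
      by rewrite E0 in E; lra.
  (* Up to o(t), the difference of the two functions at any nearby Y is this map, which does not
     depend on Y. Hence equality at one Y gives it at all. *)
  pose kap t := nfs D t r0.
  have Hkap Y : J Y -> V (std Y) -> sim (fun t => nfs l1 t (repr Y t) - nfs l2 t (repr Y t)) kap.
    move=> HY HVY.
    (* Subtracting the value at [r0] makes the grouped coefficients of exponent at most 1 flat at
       [std Y]: the value is 0 by [Hconst], the derivatives by [HDer]. *)
    pose D' := app D (List.map (fun p => (fst p, fun _ : R => - snd p r0)) D).
    have ED' t y : nfs D' t y = nfs D t y - nfs D t r0.
      rewrite /D' nfs_app /Rminus; congr (_ + _).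
      by elim: (D) => [|p s IH] /=; [ring | rewrite IH; ring].
    have EcD' c y : coef D' c y = coef D c y - coef D c r0.
      rewrite /D' coef_app /Rminus; congr (_ + _).
      elim: (D) => [|p s IH] /=; first ring.
      by rewrite IH; case: (Req_EM_T (fst p) c) => _ /=; ring.
    have HD' : good V D'.
      apply: good_app => // q /in_map_iff [p [<- /HD [h1 h2]]] /=; split=> //; exact: sm_const.
    apply: little_o_ext (_ : little_o (fun t => nfs D' t (repr Y t))).
      by apply: ev_all => t _; rewrite ED' /kap {1}/D nfs_app nfs_neg.
    apply: (nfs_flat V) => //; first exact: Ro_repr.
    rewrite -/(std Y) => c n Hc; have HYr := HJout Y HY HVY.
    case: n => [|n]; first by rewrite /= EcD' (Hconst c (std Y)) //; ring.
    rewrite -(HDer c (std Y) n Hc HYr HVY) -!Derive_n_Derive.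
    apply: Derive_n_ext_loc; apply: filter_imp (openR_locally _ _ HV HVY) => y Vy.
    rewrite (Derive_ext (coef D' c) (fun y => coef D c y + - coef D c r0)); last by move=> z; rewrite EcD'.
    rewrite Derive_plus ?Derive_const ?Rplus_0_r //; first exact: (Hs c 0%N).
    exact: ex_derive_const.
  move=> Y Y' HY HY' HnY HnY'; rewrite E1 // E2 // E1 // E2 //.
  move=> /(nf_eqP V) => /(_ HV H1 H2 HnY) Ho.
  apply/(nf_eqP V) => //.
  have HS := sim_trans _ _ _ (Hkap Y' HY' HnY') (sim_sym _ _ (Hkap Y HY HnY)).
  have := little_o_add _ _ HS Ho; apply: little_o_ext; apply: ev_all => t _; ring.
Qed.

(** * Primitives *)

(** I' = f is expressed through local normal forms and not through [deriv], so that it can be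
    restricted to part of J and glued. On all of J, [prim_onT_primitive] recovers [is_primitive]. *)
Definition prim_on (J : FR -> Prop) (f I : FR -> FR) (W : R -> Prop) : Prop :=
  forall X, J X -> W (std X) -> exists d l, rep J I (std X) d l /\
    forall Y, J Y -> near (std X) d (std Y) -> nf (dl l) Y = f Y.

Lemma prim_on_mono J f I (W W' : R -> Prop) : (forall r, W' r -> W r) -> prim_on J f I W -> prim_on J f I W'.
Proof. by move=> H HI X HX /H; apply: HI. Qed.

Lemma prim_on_ext J f I I' W : openR W -> (forall X, J X -> W (std X) -> I X = I' X) ->
  prim_on J f I W -> prim_on J f I' W.
Proof.
  move=> HW E HI X HX HWX; have [d [l [Hl Hd]]] := HI X HX HWX.
  have [e [He HeW]] := HW _ HWX; have Hd0 := proj1 Hl.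
  have Hm : 0 < Rmin d e by apply: Rmin_pos.
  have Hl' : rep J I (std X) (Rmin d e) l.
    by apply: rep_sub Hl Hm _ => y; apply: near_mono; apply: Rmin_l.
  exists (Rmin d e), l; split.
    move: Hl' => [_ [Hg Hf]]; split=> //; split=> // Y HY HnY.
    by rewrite -E ?Hf //; apply: HeW; apply: near_mono HnY; apply: Rmin_r.
  by move=> Y HY HnY; apply: Hd => //; apply: near_mono HnY; apply: Rmin_l.
Qed.

Lemma prim_on_unique J f I1 I2 W X Y : wide J ->
  (forall x y z, W x -> W y -> x < z < y -> W z) ->
  prim_on J f I1 W -> prim_on J f I2 W ->
  J X -> W (std X) -> J Y -> W (std Y) -> I1 X = I2 X -> I1 Y = I2 Y.
Proof.
  move=> HJ HW HI1 HI2 HX HWX HY HWY E.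
  have loc Z : J Z -> W (std Z) -> exists d, 0 < d /\ forall Z1 Z2, J Z1 -> J Z2 ->
      near (std Z) d (std Z1) -> near (std Z) d (std Z2) -> I1 Z1 = I2 Z1 -> I1 Z2 = I2 Z2.
    move=> HZ HWZ.
    have [d1 [l1 [Hl1 E1]]] := HI1 Z HZ HWZ; have [d2 [l2 [Hl2 E2]]] := HI2 Z HZ HWZ.
    have Hd1 := proj1 Hl1; have Hd2 := proj1 Hl2.
    have Hm : 0 < Rmin d1 d2 by apply: Rmin_pos.
    exists (Rmin d1 d2); split=> //.
    apply: (rep_diff_locally_const J I1 I2 _ l1 l2 Z) => //.
    - by apply: rep_sub Hl1 Hm _ => y; apply: near_mono; apply: Rmin_l.
    - by apply: rep_sub Hl2 Hm _ => y; apply: near_mono; apply: Rmin_r.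
    - move=> Z' HZ' HnZ'; rewrite E1 ?E2 //; apply: near_mono HnZ'; [exact: Rmin_r | exact: Rmin_l].
  pose S r := W r /\ exists Z, J Z /\ std Z = r.
  (* Many points share one standard part, so agreement over a real [r] has to mean agreement at all
     of them. *)
  pose P r := forall Z, J Z -> std Z = r -> I1 Z = I2 Z.
  suff : P (std Y) by apply.
  apply: (connected S P _ _ (std X) (std Y)).
  - move=> x y z [Wx [Zx [JZx Ex]]] [Wy [Zy [JZy Ey]]] Hz; split; first exact: HW Hz.
    exists (cst z); rewrite std_cst; split=> //.
    by apply: (proj2 HJ Zx Zy) => //; rewrite std_cst Ex Ey.
  - move=> r [Wr [Z [JZ EZ]]]; rewrite -EZ in Wr *.
    have [d [Hd H]] := loc Z JZ Wr; exists d; split=> // x y [_ [Zx [JZx Ex]]] _ Hx Hy Px Z' JZ' EZ'.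
    apply: (H Zx) => //; rewrite ?Ex ?EZ' //.
    exact: Px.
  - by split=> //; exists X.
  - by split=> //; exists Y.
  - have [d [Hd H]] := loc X HX HWX => Z JZ EZ.
    by apply: (H X) => //; rewrite ?EZ; apply: near_refl.
Qed.

(** The radius comes before [Y] and [v]: when gluing, the point and the value to match are known
    only after the neighbourhood has been fixed. *)
Lemma local_prim J f X : smooth J f -> J X -> exists d, 0 < d /\
  forall Y v, J Y -> near (std X) d (std Y) ->
    exists G, prim_on J f G (near (std X) d) /\ G Y = v.
Proof.
  move=> Hf HX.
  have [V [pd [P [p [alpha /local_rep_rep [d [l [[Hd [Hl Hfl]] _]]]]]]]] := Hf X HX.
  set r0 := std X in Hl Hfl *.
  exists d; split=> // Y v HY HnY.
  have HV := openR_near r0 d.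
  have HAl := good_prims _ _ _ Hl.
  have HR : Ro (fun t => nfs (prims r0 l) t (repr Y t)).
    by apply: (Ro_nfs (near r0 d)) => //; apply: Ro_repr.
  have HRv : Ro (fun t => repr v t + -1 * nfs (prims r0 l) t (repr Y t)).
    by apply: Ro_add; [apply: Ro_repr | apply: Ro_mul => //; apply: Ro_const].
  (* The integration constant is a Fermat real; its power sum [k] enters the normal form as constant
     coefficients. *)
  have /RoE [k [Hk Hs]] := HRv.
  pose L := app (prims r0 l) (consts k).
  have HL : good (near r0 d) L by apply: good_app => //; apply: good_consts.
  exists (nf L); split.
    move=> Z HZ HnZ; have [e [He HeV]] := HV _ HnZ.
    exists e, L; split.
      by split=> //; split=> //; apply: good_mono HL => y; apply: HeV.
    move=> Z' HZ' HnZ'; have Hn := HeV _ HnZ'.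
    rewrite Hfl //; apply: cls_eq.
      by apply: (Ro_nfs (near r0 d)) => //; [apply: good_dl | apply: Ro_repr].
    apply: sim_ev; apply: ev_mono (ev_near _ _ _ Hn) => t _ Ht.
    by rewrite dl_app nfs_app (nfs_dl_prims _ d) // nfs_dl_consts Rplus_0_r.
  rewrite -[RHS]cls_repr; apply: cls_eq.
    by apply: (Ro_nfs (near r0 d)) => //; apply: Ro_repr.
  apply: little_o_ext (little_o_opp _ Hs); apply: ev_all => t _.
  rewrite nfs_app nfs_consts; ring.
Qed.

Lemma near_interval r0 d x : near r0 d x <-> r0 - d < x < r0 + d.
Proof.
  rewrite /near; split; first by move=> /Rabs_def2; lra.
  by move=> H; apply: Rabs_def1; lra.
Qed.

Lemma openR_interval lo hi : openR (fun r => lo < r < hi).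
Proof.
  move=> x Hx; exists (Rmin (x - lo) (hi - x)); split; first by apply: Rmin_pos; lra.
  move=> y /Rabs_def2; have := Rmin_l (x - lo) (hi - x); have := Rmin_r (x - lo) (hi - x); lra.
Qed.

Lemma prim_on_cover J f I (W W1 W2 : R -> Prop) : (forall r, W r -> W1 r \/ W2 r) ->
  prim_on J f I W1 -> prim_on J f I W2 -> prim_on J f I W.
Proof. by move=> HW H1 H2 X HX /HW [h|h]; [apply: H1 | apply: H2]. Qed.

(* Local primitives, normalised at a common point, agree on overlaps and can be glued. *)
Lemma prim_to J f u X : wide J -> smooth J f -> J u -> J X ->
  exists lo hi I, lo < std u < hi /\ lo < std X < hi /\
    prim_on J f I (fun r => lo < r < hi) /\ I u = FR0.
Proof.
  move=> HJ Hf Hu HX.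
  pose S r := exists Z, J Z /\ std Z = r.
  pose Q r := exists lo hi I, lo < std u < hi /\ lo < r < hi /\
    prim_on J f I (fun r => lo < r < hi) /\ I u = FR0.
  apply: (connected S Q _ _ (std u) (std X)).
  - move=> x y z [Zx [JZx Ex]] [Zy [JZy Ey]] Hz.
    exists (cst z); rewrite std_cst; split=> //.
    by apply: (proj2 HJ Zx Zy) => //; rewrite std_cst Ex Ey.
  - move=> r [Z [JZ <-]]; have [d [Hd Hloc]] := local_prim J f Z Hf JZ.
    exists d; split=> // _ _ [Y [JY <-]] [Y' [JY' <-]] HnY HnY' [lo [hi [I [Hu0 [HY [HI HIu]]]]]].
    have [G [HG HGY]] := Hloc Y (I Y) JY HnY.
    (* [I] is kept where it is a primitive and continued by [G]. They agree at [Y], hence by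
       uniqueness on the overlap, which is again an interval. *)
    pose I' Z' := if excluded_middle_informative (lo < std Z' < hi) then I Z' else G Z'.
    have E1 Z' : lo < std Z' < hi -> I' Z' = I Z'.
      by rewrite /I'; case: excluded_middle_informative.
    have E2 Z' : J Z' -> near (std Z) d (std Z') -> I' Z' = G Z'.
      move=> JZ' Hn; rewrite /I'; case: excluded_middle_informative => //= Hi.
      apply: (prim_on_unique J f I G (fun r => lo < r < hi /\ near (std Z) d r) Y) => //.
      - by move=> x y z; rewrite !near_interval; lra.
      - by apply: prim_on_mono HI => ? [].
      - by apply: prim_on_mono HG => ? [].
    move: (HnY) (HnY') => /near_interval nY /near_interval nY'.
    exists (Rmin lo (std Z - d)), (Rmax hi (std Z + d)), I'.
    have m1 := Rmin_l lo (std Z - d); have m2 := Rmin_r lo (std Z - d).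
    have m3 := Rmax_l hi (std Z + d); have m4 := Rmax_r hi (std Z + d).
    split; first lra.
    split; first lra.
    split; last by rewrite E1.
    (* Both intervals contain [std Y], so they leave no gap in their hull. *)
    apply: (prim_on_cover _ _ _ _ (fun r => lo < r < hi) (near (std Z) d)).
    + move=> s; rewrite near_interval /Rmin /Rmax; do 2 case: Rle_dec => /= ?; lra.
    + apply: prim_on_ext HI; first exact: openR_interval.
      by move=> Z' _ /E1.
    + apply: prim_on_ext HG; first exact: openR_near.
      by move=> Z' JZ' /E2 ->.
  - by exists u.
  - by exists X.
  - have [d [Hd Hloc]] := local_prim J f u Hf Hu.
    have [I [HI HIu]] := Hloc u FR0 Hu (near_refl _ _ Hd).
    exists (std u - d), (std u + d), I; split; first lra.
    split; first lra.
    by split=> //; apply: prim_on_mono HI => r /near_interval.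
Qed.

(** By uniqueness, all primitives that vanish at [u] and live over an interval containing [std u]
    and [std X] have the same value at X. Choosing this common value makes [I] coincide with a
    single primitive around each point. *)
Lemma exists_prim J f u : wide J -> smooth J f -> J u ->
  exists I, prim_on J f I (fun _ => True) /\ I u = FR0.
Proof.
  move=> HJ Hf Hu.
  pose spec X v := forall lo hi I, lo < std u < hi -> lo < std X < hi ->
    prim_on J f I (fun r => lo < r < hi) -> I u = FR0 -> I X = v.
  have Hex X : exists v, J X -> spec X v.
    case: (classic (J X)) => HX; last by exists FR0.
    have [lo [hi [I [h1 [h2 [h3 h4]]]]]] := prim_to J f u X HJ Hf Hu HX.
    exists (I X) => _ lo' hi' I' h1' h2' h3' h4'.
    apply: (prim_on_unique J f I' I (fun r => lo < r < hi /\ lo' < r < hi') u) => //.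
    - by move=> x y z; lra.
    - by apply: prim_on_mono h3' => ? [].
    - by apply: prim_on_mono h3 => ? [].
    - by rewrite h4.
  pose I X := proj1_sig (constructive_indefinite_description _ (Hex X)).
  have HI X : J X -> spec X (I X) := proj2_sig (constructive_indefinite_description _ (Hex X)).
  exists I; split.
    move=> X HX _; have [lo [hi [I0 [h1 [h2 [h3 h4]]]]]] := prim_to J f u X HJ Hf Hu HX.
    apply: (prim_on_ext J f I0 I (fun r => lo < r < hi)) => //; first exact: openR_interval.
    by move=> Y HY HYr; apply: (HI Y HY lo hi).
  have [lo [hi [I0 [h1 [h2 [h3 h4]]]]]] := prim_to J f u u HJ Hf Hu Hu.
  by rewrite -(HI u Hu lo hi I0).
Qed.

Lemma prim_onT_primitive J f u I : wide J ->
  is_primitive J f u I <-> prim_on J f I (fun _ => True) /\ I u = FR0.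
Proof.
  move=> HJ; split.
  - move=> [Hs [HIu Hd]]; split=> // X HX _.
    have [V [pd [P [p [alpha /local_rep_rep [d [l [Hl _]]]]]]]] := Hs X HX.
    exists d, l; split=> // Y HY HnY.
    by rewrite -Hd // (deriv_rep J I (std X) d l).
  - move=> [HI HIu]; split.
      by apply: rep_smooth => X HX; have [d [l [Hl _]]] := HI X HX Logic.I; exists d, l.
    split=> // X HX; have [d [l [Hl Hd]]] := HI X HX Logic.I.
    have Hn : near (std X) d (std X) by apply: near_refl; apply: (proj1 Hl).
    by rewrite (deriv_rep J I (std X) d l) // Hd.
Qed.

Lemma integral_prim J f I u v : wide J -> J u -> J v ->
  prim_on J f I (fun _ => True) -> I u = FR0 -> integral J f u v = I v.
Proof.
  move=> HJ Hu Hv HI HIu; rewrite /integral.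
  case: excluded_middle_informative => [H|[]]; last by exists I; apply/prim_onT_primitive.
  case: constructive_indefinite_description => I' /= /(prim_onT_primitive _ _ _ _ HJ) [HI' HIu'].
  apply: (prim_on_unique J f I' I (fun _ => True) u) => //.
  by rewrite HIu.
Qed.

(** * The substitution rule *)

Lemma FRmul_cls x y : Ro x -> Ro y -> FRmul (cls x) (cls y) = cls (fun t => x t * y t).
Proof.
  move=> Hx Hy; symmetry; apply: cls_eq; first exact: Ro_mul.
  by apply: sim_mul => //; [apply: Ro_repr | apply/sim_sym/repr_cls | apply/sim_sym/repr_cls].
Qed.

(** The normal form [l] of I around [phi X] is composed with the normal form [m] of phi around X. In
    the resulting product of derivatives, [dl l] gives f at the points of phi and [dl m] gives
    phi'. *)
Lemma prim_on_comp J J1 phi f I : wide J1 -> (forall s, J1 s -> J (phi s)) -> smooth J1 phi ->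
  prim_on J f I (fun _ => True) ->
  prim_on J1 (fun s => FRmul (f (phi s)) (deriv J1 phi s)) (fun s => I (phi s)) (fun _ => True).
Proof.
  move=> HJ1 Hphi Hs HI X HX _.
  have [V [pd [P [p [alpha /local_rep_rep [d [m [Hm _]]]]]]]] := Hs X HX.
  have [d' [l [Hl HE]]] := HI _ (Hphi X HX) Logic.I.
  have [Hd [Hgm Em]] := Hm; have [Hd' [Hgl El]] := Hl.
  have phiE Y : J1 Y -> near (std X) d (std Y) ->
      Ro (fun t => nfs m t (repr Y t)) /\ std (phi Y) = nfs m 0 (std Y).
    move=> HY HnY.
    have HR : Ro (fun t => nfs m t (repr Y t)).
      by apply: (Ro_nfs _ _ _ (openR_near (std X) d)) => //; apply: Ro_repr.
    by split=> //; rewrite Em // (std_cls _ HR).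
  have HnX : near (std X) d (std X) by apply: near_refl.
  have HV0 : near (std (phi X)) d' (nfs m 0 (std X)).
    by rewrite -(proj2 (phiE X HX HnX)); apply: near_refl.
  have [V' [pd' [P' [p' [alpha' [HV' [HX' [HP' [HPp [Ha HC]]]]]]]]]] :=
    comp_rep _ _ l m (std X) (openR_near (std (phi X)) d') (openR_near (std X) d) Hgl Hgm HnX HV0.
  have Hloc : local_rep J1 (fun s => I (phi s)) X V' pd' P' p' alpha'.
    split=> //; split=> //; split=> //; split=> //; split=> // Y HY HVY.
    have [HnY [HnY' [-> _]]] := HC Y HVY.
    have [HR Hst] := phiE Y HY HnY.
    rewrite El; [|exact: Hphi | by rewrite Hst].
    by rewrite Em // (nf_sim (near (std (phi X)) d')) //; apply: openR_near.
  (* The composite is known through parameters; re-expanding it yields the list that [prim_on] asks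
     for, with the y-derivative of [alpha'] as its termwise derivative. *)
  have [e [k [Hk Ek]]] := local_rep_rep _ _ _ _ _ _ _ _ Hloc.
  have [e' [He' HeV]] := HV' _ HX'; have He := proj1 Hk.
  have Hmin : 0 < Rmin e e' by apply: Rmin_pos.
  exists (Rmin e e'), k; split.
    by apply: rep_sub Hk Hmin _ => y; apply: near_mono; apply: Rmin_l.
  move=> Y HY HnY; rewrite -Ek //; last by apply: near_mono HnY; apply: Rmin_l.
  have HVY : V' (std Y) by apply: HeV; apply: Rlt_le_trans HnY (Rmin_r _ _).
  have [HnY1 [HnY2 [_ ->]]] := HC Y HVY.
  have [HR Hst] := phiE Y HY HnY1.
  rewrite (deriv_rep J1 phi (std X) d m) // -HE; [|exact: Hphi | by rewrite Hst].
  rewrite Em // (nf_sim (near (std (phi X)) d')) //; first last.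
  - exact: good_dl.
  - exact: openR_near.
  rewrite FRmul_cls //.
    by apply: (Ro_nfs (near (std (phi X)) d') _ (fun t => nfs m t (repr Y t))) => //; [apply: openR_near | apply: good_dl].
  by apply: (Ro_nfs (near (std X) d)) => //; [apply: openR_near | apply: good_dl | apply: Ro_repr].
Qed.

Theorem theorem19 (J J1 : FR -> Prop) (u v : FR) (phi f : FR -> FR) :
  noninf_interval J -> noninf_interval J1 ->
  J1 u -> J1 v ->
  (forall s, J1 s -> J (phi s)) ->
  smooth J1 phi -> smooth J f ->
  integral J f (phi u) (phi v) =
  integral J1 (fun s => FRmul (f (phi s)) (deriv J1 phi s)) u v.
Proof.
  move=> /noninf_wide HJ /noninf_wide HJ1 Hu Hv Hphi Hsphi Hf.
  have [I [HI HIu]] := exists_prim J f (phi u) HJ Hf (Hphi u Hu).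
  rewrite (integral_prim J f I) //; try exact: Hphi.
  rewrite (integral_prim J1 _ (fun s => I (phi s))) //.
  exact: prim_on_comp HI.
Qed.
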